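(* Every $\mathbf{SMC}$-category is biequivalent to a $\mathbf{PC}$-category via a map of $\mathbf{SMC}$-categories. That is, for every $\mathbf{SMC}$-category $\mathbf{B}$ there exist a $\mathbf{PC}$-category $\mathbf{C}$ (regarded as an $\mathbf{SMC}$-category) and an $\mathbf{SMC}$-functor $F:\mathbf{B}\to\mathbf{C}$ which is a biequivalence of $\mathbf{SMC}$-categories.
   Context: Size issues are ignored; $\mathbf{CAT}$ is the $2$-category of categories. A permutative category is a symmetric monoidal category whose monoidal product is strictly associative and strictly unital. **$\mathbf{SMC}$-category.** An $\mathbf{SMC}$-category is a bicategory $\mathbf{B}$ together with, for each pair $a,b$ of $0$-cells, a symmetric monoidal structure $(\oplus,\mathbf{0})$ on the category $\mathbf{B}(a,b)$, such that for each triple $a,b,c$ the composition functor $\circ:\mathbf{B}(b,c)\times\mathbf{B}(a,b)\to\mathbf{B}(a,c)$ is bilinear: its two adjoints $\mathbf{B}(b,c)\to\mathbf{CAT}(\mathbf{B}(a,b),\mathbf{B}(a,c))$, $f\mapsto f\circ-$, and $\mathbf{B}(a,b)\to\mathbf{CAT}(\mathbf{B}(b,c),\mathbf{B}(a,c))$, $f\mapsto -\circ f$, are equipped with symmetric strong monoidal structures (the functor categories having the pointwise symmetric monoidal structure from $\mathbf{B}(a,c)$). Thus one has natural isomorphisms $(f\oplus g)\circ h\cong f\circ h\oplus g\circ h$, $f\circ(g\oplus h)\cong f\circ g\oplus f\circ h$, $\mathbf{0}\circ h\cong\mathbf{0}$, $f\circ\mathbf{0}\cong\mathbf{0}$, and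 each functor $f\circ-$ and $-\circ f$ becomes a symmetric strong monoidal functor. A pointwise sum $F\oplus G$ of symmetric strong monoidal functors is again symmetric strong monoidal (using the symmetry of the target). It is required that: (1) the isomorphisms $(f\oplus g)\circ-\cong(f\circ-)\oplus(g\circ-)$, $-\circ(f\oplus g)\cong(-\circ f)\oplus(-\circ g)$, $\mathbf{0}\circ-\cong\mathbf{0}$ and $-\circ\mathbf{0}\cong\mathbf{0}$ are isomorphisms of monoidal functors; (2) the isomorphisms $f\circ(g\circ-)\cong(f\circ g)\circ-$, $(-\circ f)\circ g\cong-\circ(f\circ g)$, $f\circ(-\circ g)\cong(f\circ-)\circ g$, $-\circ\mathbf{1}\cong\mathrm{id}$ and $\mathbf{1}\circ-\cong\mathrm{id}$ given by the associativity and unit constraints of $\mathbf{B}$ are isomorphisms of monoidal functors. **$\mathbf{PC}$-category.** A $\mathbf{PC}$-category is a (strict) $2$-category $\mathbf{C}$ together with a permutative category structure on each $\mathbf{C}(c,d)$, such that $f\mapsto f\circ-$, $\mathbf{C}(b,c)\to\mathbf{CAT}(\mathbf{C}(a,b),\mathbf{C}(a,c))$, is equipped with a symmetric strict monoidal structure (so $(f\oplus g)\circ h=f\circ h\oplus g\circ h$ and $\mathbf{0}\circ h=\mathbf{0}$), and $f\mapsto-\circ f$, $\mathbf{C}(a,b)\to\mathbf{CAT}(\mathbf{C}(b,c),\mathbf{C}(a,c))$, is equipped with a symmetric strong monoidal, strictly unital structure (so there is a natural isomorphism $f\circ(g\oplus h)\cong f\circ g\oplus f\circ h$, and $f\circ\mathbf{0}=\mathbf{0}$),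 and conditions (1) and (2) above hold. In particular a $\mathbf{PC}$-category is an $\mathbf{SMC}$-category. **$\mathbf{SMC}$-functor.** For $\mathbf{SMC}$-categories $\mathbf{B},\mathbf{C}$, an $\mathbf{SMC}$-functor (map of $\mathbf{SMC}$-categories) $F:\mathbf{B}\to\mathbf{C}$ is a (strong) functor of bicategories (pseudofunctor) such that each $F:\mathbf{B}(a,b)\to\mathbf{C}(Fa,Fb)$ is equipped with a symmetric strong monoidal structure, and such that the constraint isomorphisms relating $F(g)\circ F(f)$ and $F(g\circ f)$ are monoidal transformations in $g\in\mathbf{B}(b,c)$ for each fixed $f\in\mathbf{B}(a,b)$, and monoidal transformations in $f$ for each fixed $g$. **Monoidal transformation.** For $\mathbf{SMC}$-functors $F,G:\mathbf{B}\to\mathbf{C}$, a (strong) monoidal transformation $\eta:F\Rightarrow G$ is a strong (pseudonatural) transformation of functors of bicategories such that for all $a,b$ the natural isomorphism $\eta_f:G(f)\circ\eta_a\Rightarrow\eta_b\circ F(f)$, $f\in\mathbf{B}(a,b)$, is a monoidal transformation between monoidal functors $\mathbf{B}(a,b)\to\mathbf{C}(Fa,Gb)$. Let $\mathbf{SMC\text{-}Cat}(\mathbf{B},\mathbf{C})$ be the bicategory of $\mathbf{SMC}$-functors, strong monoidal transformations, and (ordinary bicategorical) modifications. **Biequivalence.** A biequivalence of $\mathbf{SMC}$-categories from $\mathbf{B}$ to $\mathbf{C}$ consists of $\mathbf{SMC}$-functors $F:\mathbf{B}\to\mathbf{C}$ and $G:\mathbf{C}\to\mathbf{B}$ together with an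 equivalence $FG\simeq1_{\mathbf{C}}$ in the bicategory $\mathbf{SMC\text{-}Cat}(\mathbf{C},\mathbf{C})$ and an equivalence $1_{\mathbf{B}}\simeq GF$ in $\mathbf{SMC\text{-}Cat}(\mathbf{B},\mathbf{B})$. An $\mathbf{SMC}$-functor $F$ is called a biequivalence if it is part of such data. *)

(* Defs.v *)
From Corelib Require Import ssreflect.
From Stdlib Require Import FunctionalExtensionality ProofIrrelevance.

Set Implicit Arguments.
Unset Strict Implicit.
Unset Printing Implicit Defensive.

Declare Scope cat_scope.
Delimit Scope cat_scope with cat.
Local Open Scope cat_scope.

Record Category := {
  obj :> Type;
  hom : obj -> obj -> Type;
  idm : forall x, hom x x;
  comp : forall {x y z}, hom y z -> hom x y -> hom x z;
  comp_id_l : forall x y (f : hom x y), comp (idm y) f = f;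
  comp_id_r : forall x y (f : hom x y), comp f (idm x) = f;
  comp_assoc : forall x y z w (h : hom z w) (g : hom y z) (f : hom x y),
    comp (comp h g) f = comp h (comp g f)
}.
Arguments hom {_} _ _.
Arguments idm {_} _.
Arguments comp {_ _ _ _} _ _.
Notation "g ∘ f" := (comp g f) (at level 40, left associativity) : cat_scope.

Record Iso {M : Category} (x y : M) := {
  fwd :> hom x y;
  bwd : hom y x;
  bwd_fwd : bwd ∘ fwd = idm x;
  fwd_bwd : fwd ∘ bwd = idm y
}.
Arguments bwd {_ _ _} _.

Definition IsIso {M : Category} {x y : M} (f : hom x y) : Prop :=
  exists g : hom y x, g ∘ f = idm x /\ f ∘ g = idm y.

(* A morphism between two a priori different objects "is an identity" when
   the objects are equal and it is the identity along that equality. *)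
Definition eqHom {M : Category} {x y : M} (e : x = y) : hom x y :=
  match e in _ = z return hom x z with eq_refl => idm x end.

Definition IsIdentity {M : Category} {x y : M} (f : hom x y) : Prop :=
  exists e : x = y, f = eqHom e.

Record Functor (M N : Category) := {
  fob :> M -> N;
  fmap : forall {x y}, hom x y -> hom (fob x) (fob y);
  fmap_id : forall x, fmap (idm x) = idm (fob x);
  fmap_comp : forall x y z (g : hom y z) (f : hom x y),
    fmap (g ∘ f) = fmap g ∘ fmap f
}.
Arguments fmap {_ _} _ {_ _} _.

Record NatTrans {M N : Category} (F G : Functor M N) := {
  nt :> forall x, hom (F x) (G x);
  nt_nat : forall x y (f : hom x y), nt y ∘ fmap F f = fmap G f ∘ nt x
}.

Lemma nt_eq {M N : Category} {F G : Functor M N} (s t : NatTrans F G) :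
  (forall x, s x = t x) -> s = t.
Proof.
case: s t => [s hs] [t ht] /= e.
have {}e : s = t by apply: functional_extensionality_dep.
case: t / e ht => ht; congr Build_NatTrans; exact: proof_irrelevance.
Qed.

Lemma assoc2 {M : Category} {x y z : M} {g : hom y z} {f : hom x y} {k} :
  g ∘ f = k -> forall w (u : hom w x), g ∘ (f ∘ u) = k ∘ u.
Proof. by move=> <- w u; rewrite comp_assoc. Qed.

Lemma assoc3 {M : Category} {x y z t : M}
    {h : hom z t} {g : hom y z} {f : hom x y} {k} :
  h ∘ (g ∘ f) = k -> forall w (u : hom w x), h ∘ (g ∘ (f ∘ u)) = k ∘ u.
Proof. by move=> <- w u; rewrite !comp_assoc. Qed.

Lemma iso_cancel_l {M : Category} {x y z : M} (i : Iso y z) (f g : hom x y) :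
  i ∘ f = i ∘ g -> f = g.
Proof.
move=> e.
by rewrite -(comp_id_l f) -(comp_id_l g) -(bwd_fwd i) !comp_assoc e.
Qed.

Lemma iso_cancel_r {M : Category} {x y z : M} (i : Iso x y) (f g : hom y z) :
  f ∘ i = g ∘ i -> f = g.
Proof.
move=> e.
by rewrite -(comp_id_r f) -(comp_id_r g) -(fwd_bwd i) -!comp_assoc e.
Qed.

Definition isoId {M : Category} (x : M) : Iso x x :=
  {| fwd := idm x; bwd := idm x;
     bwd_fwd := comp_id_l (idm x); fwd_bwd := comp_id_l (idm x) |}.

Definition isoInv {M : Category} {x y : M} (i : Iso x y) : Iso y x :=
  {| fwd := bwd i; bwd := fwd i;
     bwd_fwd := fwd_bwd i; fwd_bwd := bwd_fwd i |}.

Definition isoComp {M : Category} {x y z : M} (j : Iso y z) (i : Iso x y) :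
  Iso x z.
Proof.
refine {| fwd := j ∘ i; bwd := bwd i ∘ bwd j |}.
- abstract (by rewrite comp_assoc (assoc2 (bwd_fwd j)) comp_id_l bwd_fwd).
- abstract (by rewrite comp_assoc (assoc2 (fwd_bwd i)) comp_id_l fwd_bwd).
Defined.

Definition isoMap {M N : Category} (F : Functor M N) {x y : M} (i : Iso x y) :
  Iso (F x) (F y).
Proof.
refine {| fwd := fmap F i; bwd := fmap F (bwd i) |}.
- abstract (by rewrite -fmap_comp bwd_fwd fmap_id).
- abstract (by rewrite -fmap_comp fwd_bwd fmap_id).
Defined.

Definition idFun (M : Category) : Functor M M :=
  {| fob := fun x => x; fmap := fun x y f => f;
     fmap_id := fun x => eq_refl; fmap_comp := fun x y z g f => eq_refl |}.

Definition compFun {M N P : Category} (G : Functor N P) (F : Functor M N) :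
  Functor M P.
Proof.
refine {| fob := fun x => G (F x); fmap := fun x y f => fmap G (fmap F f) |}.
- abstract (by move=> x; rewrite !fmap_id).
- abstract (by move=> x y z g f; rewrite !fmap_comp).
Defined.

Definition constFun (M : Category) {N : Category} (c : N) : Functor M N.
Proof.
refine {| fob := fun _ => c; fmap := fun x y f => idm c |}.
- abstract by [].
- abstract (by move=> *; rewrite comp_id_l).
Defined.

Definition idNat {M N : Category} (F : Functor M N) : NatTrans F F.
Proof.
refine {| nt := fun x => idm (F x) |}.
abstract (by move=> x y f; rewrite comp_id_l comp_id_r).
Defined.

Definition compNat {M N : Category} {F G H : Functor M N}
    (t : NatTrans G H) (s : NatTrans F G) : NatTrans F H.
Proof.
refine {| nt := fun x => t x ∘ s x |}.
abstract (by move=> x y f;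
  rewrite comp_assoc nt_nat -comp_assoc nt_nat comp_assoc).
Defined.

Definition CAT (M N : Category) : Category.
Proof.
refine {| obj := Functor M N; hom := @NatTrans M N;
          idm := @idNat M N; comp := @compNat M N |}.
- abstract (by move=> F G s; apply: nt_eq => x; exact: comp_id_l).
- abstract (by move=> F G s; apply: nt_eq => x; exact: comp_id_r).
- abstract (by move=> *; apply: nt_eq => x; exact: comp_assoc).
Defined.

Definition natIso {M N : Category} {F G : Functor M N}
    (i : forall x, Iso (F x) (G x))
    (nat : forall x y (f : hom x y), i y ∘ fmap F f = fmap G f ∘ i x) :
  @Iso (CAT M N) F G.
Proof.
unshelve refine (@Build_Iso (CAT M N) F G _ _ _ _).
- exact: {| nt := fun x => fwd (i x); nt_nat := nat |}.
- refine {| nt := fun x => bwd (i x) |}.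
  abstract (move=> x y f; apply: (iso_cancel_l (i := i y));
    rewrite (assoc2 (fwd_bwd _)) comp_id_l (assoc2 (nat _ _ _)) comp_assoc
            fwd_bwd comp_id_r //).
- abstract (by apply: nt_eq => x; exact: bwd_fwd).
- abstract (by apply: nt_eq => x; exact: fwd_bwd).
Defined.

Definition isoAt {M N : Category} {F G : Functor M N}
    (i : @Iso (CAT M N) F G) (x : M) : Iso (F x) (G x).
Proof.
refine {| fwd := fwd i x; bwd := bwd i x |}.
- abstract (exact: (f_equal (fun s : NatTrans F F => s x) (bwd_fwd i))).
- abstract (exact: (f_equal (fun s : NatTrans G G => s x) (fwd_bwd i))).
Defined.

Definition Prod (M N : Category) : Category.
Proof.
refine {| obj := (M * N)%type;
          hom := fun p q => (hom (fst p) (fst q) * hom (snd p) (snd q))%type;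
          idm := fun p => (idm (fst p), idm (snd p));
          comp := fun p q r g f => (fst g ∘ fst f, snd g ∘ snd f) |}.
- abstract (by move=> [x y] [x' y'] [f g] /=; rewrite !comp_id_l).
- abstract (by move=> [x y] [x' y'] [f g] /=; rewrite !comp_id_r).
- abstract (by move=> *; rewrite /= !comp_assoc).
Defined.

Definition bob {X Y Z : Category} (H : Functor (Prod X Y) Z) (x : X) (y : Y) :
  Z := fob H (x, y).

Definition bmap {X Y Z : Category} (H : Functor (Prod X Y) Z) {x x' : X}
    {y y' : Y} (f : hom x x') (g : hom y y') : hom (bob H x y) (bob H x' y') :=
  @fmap _ _ H (x, y) (x', y') (f, g).

Section Bifunctor.
Context {X Y Z : Category} (H : Functor (Prod X Y) Z).

Lemma bmap_id x y : bmap H (idm x) (idm y) = idm (bob H x y).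
Proof. exact: (fmap_id H (x, y)). Qed.

Lemma bmap_comp x x' x'' y y' y'' (f' : hom x' x'') (f : hom x x')
    (g' : hom y' y'') (g : hom y y') :
  bmap H (f' ∘ f) (g' ∘ g) = bmap H f' g' ∘ bmap H f g.
Proof. exact: (@fmap_comp _ _ H (x, y) (x', y') (x'', y'') (f', g') (f, g)). Qed.

Lemma bmap_lr x x' y y' (f : hom x x') (g : hom y y') :
  bmap H f g = bmap H f (idm y') ∘ bmap H (idm x) g.
Proof. by rewrite -bmap_comp comp_id_l comp_id_r. Qed.

Lemma bmap_rl x x' y y' (f : hom x x') (g : hom y y') :
  bmap H f g = bmap H (idm x') g ∘ bmap H f (idm y).
Proof. by rewrite -bmap_comp comp_id_l comp_id_r. Qed.

Definition fixL (x : X) : Functor Y Z.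
Proof.
refine {| fob := fun y => bob H x y; fmap := fun y y' g => bmap H (idm x) g |}.
- abstract (by move=> y; exact: bmap_id).
- abstract (by move=> *; rewrite -bmap_comp comp_id_l).
Defined.

Definition fixR (y : Y) : Functor X Z.
Proof.
refine {| fob := fun x => bob H x y; fmap := fun x x' f => bmap H f (idm y) |}.
- abstract (by move=> x; exact: bmap_id).
- abstract (by move=> *; rewrite -bmap_comp comp_id_l).
Defined.

Definition fixL_nat {x x' : X} (f : hom x x') : NatTrans (fixL x) (fixL x').
Proof.
refine (@Build_NatTrans _ _ (fixL x) (fixL x') (fun y => bmap H f (idm y)) _).
abstract (by move=> *; rewrite /= -bmap_lr -bmap_rl).
Defined.

Definition fixR_nat {y y' : Y} (g : hom y y') : NatTrans (fixR y) (fixR y').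
Proof.
refine (@Build_NatTrans _ _ (fixR y) (fixR y') (fun x => bmap H (idm x) g) _).
abstract (by move=> *; rewrite /= -bmap_lr -bmap_rl).
Defined.

Definition curryL : Functor X (CAT Y Z).
Proof.
refine (@Build_Functor X (CAT Y Z) fixL (@fixL_nat) _ _).
- abstract (by move=> x; apply: nt_eq => y; exact: bmap_id).
- abstract (by move=> *; apply: nt_eq => y /=; rewrite -bmap_comp comp_id_l).
Defined.

Definition curryR : Functor Y (CAT X Z).
Proof.
refine (@Build_Functor Y (CAT X Z) fixR (@fixR_nat) _ _).
- abstract (by move=> y; apply: nt_eq => x; exact: bmap_id).
- abstract (by move=> *; apply: nt_eq => x /=; rewrite -bmap_comp comp_id_l).
Defined.

Definition bmapIso {x x' : X} {y y' : Y} (i : Iso x x') (j : Iso y y') :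
  Iso (bob H x y) (bob H x' y').
Proof.
refine {| fwd := bmap H i j; bwd := bmap H (bwd i) (bwd j) |}.
- abstract (by rewrite -bmap_comp !bwd_fwd bmap_id).
- abstract (by rewrite -bmap_comp !fwd_bwd bmap_id).
Defined.

End Bifunctor.

Record SymMon (M : Category) := {
  tens : Functor (Prod M M) M;
  munit : M;
  sassoc : forall x y z,
    Iso (bob tens (bob tens x y) z) (bob tens x (bob tens y z));
  slun : forall x, Iso (bob tens munit x) x;
  srun : forall x, Iso (bob tens x munit) x;
  sbraid : forall x y, hom (bob tens x y) (bob tens y x);
  sassoc_nat : forall x x' y y' z z'
      (f : hom x x') (g : hom y y') (h : hom z z'),
    sassoc x' y' z' ∘ bmap tens (bmap tens f g) h =
    bmap tens f (bmap tens g h) ∘ sassoc x y z;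
  slun_nat : forall x x' (f : hom x x'),
    slun x' ∘ bmap tens (idm munit) f = f ∘ slun x;
  srun_nat : forall x x' (f : hom x x'),
    srun x' ∘ bmap tens f (idm munit) = f ∘ srun x;
  sbraid_nat : forall x x' y y' (f : hom x x') (g : hom y y'),
    sbraid x' y' ∘ bmap tens f g = bmap tens g f ∘ sbraid x y;
  spentagon : forall w x y z,
    sassoc w x (bob tens y z) ∘ sassoc (bob tens w x) y z =
    bmap tens (idm w) (sassoc x y z) ∘
      (sassoc w (bob tens x y) z ∘ bmap tens (sassoc w x y) (idm z));
  striangle : forall x y,
    bmap tens (idm x) (slun y) ∘ sassoc x munit y = bmap tens (srun x) (idm y);
  shexagon : forall x y z,
    sassoc y z x ∘ (sbraid x (bob tens y z) ∘ sassoc x y z) =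
    bmap tens (idm y) (sbraid x z) ∘
      (sassoc y x z ∘ bmap tens (sbraid x y) (idm z));
  ssym : forall x y, sbraid y x ∘ sbraid x y = idm (bob tens x y)
}.
Arguments tens {_} _.
Arguments munit {_} _.
Arguments sassoc {_} _ _ _ _.
Arguments slun {_} _ _.
Arguments srun {_} _ _.
Arguments sbraid {_} _ _ _.

Notation oplus S x y := (bob (tens S) x y).
Notation oplusm S f g := (bmap (tens S) f g).

Definition IsPermutative {M : Category} (S : SymMon M) : Prop :=
  (forall x y z, IsIdentity (sassoc S x y z)) /\
  (forall x, IsIdentity (slun S x)) /\
  (forall x, IsIdentity (srun S x)).

Section Pointwise.
Context (M : Category) {N : Category} (S : SymMon N).

Definition pwob (F G : Functor M N) : Functor M N.
Proof.
refine {| fob := fun x => oplus S (F x) (G x);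
          fmap := fun x y f => oplusm S (fmap F f) (fmap G f) |}.
- abstract (by move=> x; rewrite !fmap_id bmap_id).
- abstract (by move=> *; rewrite !fmap_comp bmap_comp).
Defined.

Definition pwmap {F F' G G' : Functor M N} (s : NatTrans F F')
    (t : NatTrans G G') : NatTrans (pwob F G) (pwob F' G').
Proof.
refine (@Build_NatTrans _ _ (pwob F G) (pwob F' G')
  (fun x => oplusm S (s x) (t x)) _).
abstract (by move=> *; rewrite /= -!bmap_comp !nt_nat).
Defined.

Definition pwtens : Functor (Prod (CAT M N) (CAT M N)) (CAT M N).
Proof.
refine (@Build_Functor (Prod (CAT M N) (CAT M N)) (CAT M N)
  (fun p => pwob (fst p) (snd p))
  (fun p q st => pwmap (fst st) (snd st)) _ _).
- abstract (by move=> *; apply: nt_eq => x; exact: bmap_id).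
- abstract (by move=> *; apply: nt_eq => x; exact: bmap_comp).
Defined.

Definition pwbraid (F G : Functor M N) : NatTrans (pwob F G) (pwob G F).
Proof.
refine (@Build_NatTrans _ _ (pwob F G) (pwob G F)
  (fun x => sbraid S (F x) (G x)) _).
abstract (by move=> *; exact: sbraid_nat).
Defined.

Definition pwSymMon : SymMon (CAT M N).
Proof.
unshelve refine (@Build_SymMon (CAT M N) pwtens (constFun M (munit S))
  _ _ _ pwbraid _ _ _ _ _ _ _ _).
- move=> F G H; apply: (@natIso M N (pwob (pwob F G) H) (pwob F (pwob G H))
    (fun x => sassoc S (F x) (G x) (H x))).
  abstract (by move=> *; exact: sassoc_nat).
- move=> F; apply: (@natIso M N (pwob (constFun M (munit S)) F) F
    (fun x => slun S (F x))).
  abstract (by move=> *; exact: slun_nat).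
- move=> F; apply: (@natIso M N (pwob F (constFun M (munit S))) F
    (fun x => srun S (F x))).
  abstract (by move=> *; exact: srun_nat).
- abstract (by move=> *; apply: nt_eq => x; exact: sassoc_nat).
- abstract (by move=> *; apply: nt_eq => x; exact: slun_nat).
- abstract (by move=> *; apply: nt_eq => x; exact: srun_nat).
- abstract (by move=> *; apply: nt_eq => x; exact: sbraid_nat).
- abstract (by move=> *; apply: nt_eq => x; exact: spentagon).
- abstract (by move=> *; apply: nt_eq => x; exact: striangle).
- abstract (by move=> *; apply: nt_eq => x; exact: shexagon).
- abstract (by move=> *; apply: nt_eq => x; exact: ssym).
Defined.

End Pointwise.

Record MonData {M N : Category} (SM : SymMon M) (SN : SymMon N)
    (F : Functor M N) := {
  mphi : forall x y, Iso (oplus SN (F x) (F y)) (F (oplus SM x y));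
  mphi0 : Iso (munit SN) (F (munit SM))
}.
Arguments mphi {_ _ _ _ _} _ _ _.
Arguments mphi0 {_ _ _ _ _} _.

Record SymStrong {M N : Category} (SM : SymMon M) (SN : SymMon N)
    (F : Functor M N) := {
  mdata :> MonData SM SN F;
  mphi_nat : forall x x' y y' (f : hom x x') (g : hom y y'),
    mphi mdata x' y' ∘ oplusm SN (fmap F f) (fmap F g) =
    fmap F (oplusm SM f g) ∘ mphi mdata x y;
  mphi_assoc : forall x y z,
    fmap F (sassoc SM x y z) ∘
      (mphi mdata (oplus SM x y) z ∘ oplusm SN (mphi mdata x y) (idm (F z))) =
    mphi mdata x (oplus SM y z) ∘
      (oplusm SN (idm (F x)) (mphi mdata y z) ∘ sassoc SN (F x) (F y) (F z));
  mphi_lun : forall x,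
    fmap F (slun SM x) ∘
      (mphi mdata (munit SM) x ∘ oplusm SN (mphi0 mdata) (idm (F x))) =
    slun SN (F x);
  mphi_run : forall x,
    fmap F (srun SM x) ∘
      (mphi mdata x (munit SM) ∘ oplusm SN (idm (F x)) (mphi0 mdata)) =
    srun SN (F x);
  mphi_braid : forall x y,
    fmap F (sbraid SM x y) ∘ mphi mdata x y =
    mphi mdata y x ∘ sbraid SN (F x) (F y)
}.

Definition IsStrictlyUnital {M N : Category} {SM : SymMon M} {SN : SymMon N}
    {F : Functor M N} (d : MonData SM SN F) : Prop := IsIdentity (mphi0 d).

Definition IsStrictMon {M N : Category} {SM : SymMon M} {SN : SymMon N}
    {F : Functor M N} (d : MonData SM SN F) : Prop :=
  (forall x y, IsIdentity (mphi d x y)) /\ IsStrictlyUnital d.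

(* Stated for a family of components; naturality of the family is always
   known separately where this is used. *)
Definition IsMonoidal {M N : Category} {SM : SymMon M} {SN : SymMon N}
    {F G : Functor M N} (d : MonData SM SN F) (e : MonData SM SN G)
    (t : forall x, hom (F x) (G x)) : Prop :=
  (forall x y,
    t (oplus SM x y) ∘ mphi d x y = mphi e x y ∘ oplusm SN (t x) (t y)) /\
  t (munit SM) ∘ mphi0 d = mphi0 e.

Definition idData {M : Category} (S : SymMon M) : MonData S S (idFun M) :=
  @Build_MonData _ _ S S (idFun M) (fun x y => isoId _) (isoId _).

Definition compData {M N P : Category} {SM : SymMon M} {SN : SymMon N}
    {SP : SymMon P} {G : Functor N P} {F : Functor M N}
    (e : MonData SN SP G) (d : MonData SM SN F) :
  MonData SM SP (compFun G F) :=
  @Build_MonData _ _ SM SP (compFun G F)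
    (fun x y => isoComp (isoMap G (mphi d x y)) (mphi e (F x) (F y)))
    (isoComp (isoMap G (mphi0 d)) (mphi0 e)).

Definition constData {M N : Category} (SM : SymMon M) (SN : SymMon N) :
  MonData SM SN (constFun M (munit SN)) :=
  @Build_MonData _ _ SM SN (constFun M (munit SN))
    (fun x y => slun SN (munit SN)) (isoId _).

Definition braidIso {M : Category} (S : SymMon M) (x y : M) :
  Iso (oplus S x y) (oplus S y x) :=
  {| fwd := sbraid S x y; bwd := sbraid S y x;
     bwd_fwd := ssym S x y; fwd_bwd := ssym S y x |}.

Definition interchange {M : Category} (S : SymMon M) (a b c d : M) :
  Iso (oplus S (oplus S a b) (oplus S c d))
      (oplus S (oplus S a c) (oplus S b d)) :=
  isoComp (isoInv (sassoc S a c (oplus S b d)))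
  (isoComp (bmapIso (tens S) (isoId a)
     (isoComp (sassoc S c b d)
     (isoComp (bmapIso (tens S) (braidIso S b c) (isoId d))
              (isoInv (sassoc S b c d)))))
  (sassoc S a b (oplus S c d))).

Definition sumData {M N : Category} {SM : SymMon M} {SN : SymMon N}
    {F G : Functor M N} (d : MonData SM SN F) (e : MonData SM SN G) :
  MonData SM SN (pwob SN F G) :=
  @Build_MonData _ _ SM SN (pwob SN F G)
    (fun x y => isoComp (bmapIso (tens SN) (mphi d x y) (mphi e x y))
                        (interchange SN (F x) (G x) (F y) (G y)))
    (isoComp (bmapIso (tens SN) (mphi0 d) (mphi0 e))
             (isoInv (slun SN (munit SN)))).

Definition idStrong {M : Category} (S : SymMon M) : SymStrong S S (idFun M).
Proof.
refine {| mdata := idData S |}.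
all: abstract (by move=> *; rewrite /= ?bmap_id ?comp_id_r ?comp_id_l).
Defined.

Lemma bmap_comp_l {X Y Z : Category} (H : Functor (Prod X Y) Z) (x : X)
    (y y' y'' : Y) (g : hom y' y'') (f : hom y y') :
  bmap H (idm x) (g ∘ f) = bmap H (idm x) g ∘ bmap H (idm x) f.
Proof. by rewrite -bmap_comp comp_id_l. Qed.

Lemma bmap_comp_r {X Y Z : Category} (H : Functor (Prod X Y) Z) (y : Y)
    (x x' x'' : X) (g : hom x' x'') (f : hom x x') :
  bmap H (g ∘ f) (idm y) = bmap H g (idm y) ∘ bmap H f (idm y).
Proof. by rewrite -bmap_comp comp_id_l. Qed.

Section StrongFacts.
Context {M N : Category} {SM : SymMon M} {SN : SymMon N} {F : Functor M N}
  (d : SymStrong SM SN F).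

Lemma mphi_nat_l x y y' (g : hom y y') :
  mphi d x y' ∘ oplusm SN (idm (F x)) (fmap F g) =
  fmap F (oplusm SM (idm x) g) ∘ mphi d x y.
Proof. by rewrite -(mphi_nat d) fmap_id. Qed.

Lemma mphi_nat_r x x' y (f : hom x x') :
  mphi d x' y ∘ oplusm SN (fmap F f) (idm (F y)) =
  fmap F (oplusm SM f (idm y)) ∘ mphi d x y.
Proof. by rewrite -(mphi_nat d) fmap_id. Qed.
End StrongFacts.

Definition compStrong {M N P : Category} {SM : SymMon M} {SN : SymMon N}
    {SP : SymMon P} {G : Functor N P} {F : Functor M N}
    (e : SymStrong SN SP G) (d : SymStrong SM SN F) :
  SymStrong SM SP (compFun G F).
Proof.
refine {| mdata := compData e d |}.
- abstract (move=> x x' y y' f g;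
  by rewrite /= comp_assoc (mphi_nat e) -!comp_assoc -!fmap_comp (mphi_nat d)).
- abstract (move=> x y z /=;
  rewrite bmap_comp_r bmap_comp_l !comp_assoc;
  rewrite (assoc2 (mphi_nat_r e _ _)) (assoc2 (mphi_nat_l e _ _)) !comp_assoc;
  rewrite -(mphi_assoc e) -!comp_assoc -!fmap_comp;
  by rewrite !comp_assoc (mphi_assoc d)).
- abstract (move=> x /=; rewrite bmap_comp_r !comp_assoc;
  rewrite (assoc2 (mphi_nat_r e _ _)) -(mphi_lun e) -(mphi_lun d);
  by rewrite !fmap_comp !comp_assoc).
- abstract (move=> x /=; rewrite bmap_comp_l !comp_assoc;
  rewrite (assoc2 (mphi_nat_l e _ _)) -(mphi_run e) -(mphi_run d);
  by rewrite !fmap_comp !comp_assoc).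
- abstract (move=> x y /=;
  by rewrite comp_assoc -(mphi_braid e) -!comp_assoc -!fmap_comp mphi_braid).
Defined.

Section Monoidal.
Context {M N P Q : Category} {SM : SymMon M} {SN : SymMon N} {SP : SymMon P}
  {SQ : SymMon Q}.

Lemma mon_comp {F G H : Functor M N} {d : MonData SM SN F}
    {e : MonData SM SN G} {k : MonData SM SN H}
    {t : forall x, hom (G x) (H x)} {s : forall x, hom (F x) (G x)} :
  IsMonoidal e k t -> IsMonoidal d e s -> IsMonoidal d k (fun x => t x ∘ s x).
Proof.
move=> [t1 t2] [s1 s2]; split=> [x y|]; last by rewrite comp_assoc s2.
by rewrite comp_assoc s1 -comp_assoc t1 comp_assoc -bmap_comp.
Qed.

Lemma mon_inv {F G : Functor M N} {d : MonData SM SN F}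
    {e : MonData SM SN G} (t : forall x, Iso (F x) (G x)) :
  IsMonoidal d e (fun x => t x) -> IsMonoidal e d (fun x => bwd (t x)).
Proof.
move=> [t1 t2]; split=> [x y|].
- apply: (iso_cancel_l (i := t _)).
  rewrite -comp_assoc fwd_bwd comp_id_l -comp_assoc t1 comp_assoc -bmap_comp.
  by rewrite !fwd_bwd bmap_id comp_id_r.
- apply: (iso_cancel_l (i := t _)).
  by rewrite -comp_assoc fwd_bwd comp_id_l t2.
Qed.

Lemma mon_pre {F G : Functor N P} {H : Functor M N} {d : MonData SN SP F}
    {e : MonData SN SP G} (k : MonData SM SN H)
    {t : forall x, hom (F x) (G x)} :
  IsMonoidal d e t ->
  (forall x y (f : hom x y), t y ∘ fmap F f = fmap G f ∘ t x) ->
  IsMonoidal (compData d k) (compData e k) (fun x => t (H x)).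
Proof.
move=> [t1 t2] nat; split=> [x y|] /=.
- by rewrite -comp_assoc nat comp_assoc t1 comp_assoc.
- by rewrite -comp_assoc nat comp_assoc t2.
Qed.

Lemma mon_post {F G : Functor M N} {H : Functor N P} {d : MonData SM SN F}
    {e : MonData SM SN G} (k : SymStrong SN SP H)
    {t : forall x, hom (F x) (G x)} :
  IsMonoidal d e t ->
  IsMonoidal (compData k d) (compData k e) (fun x => fmap H (t x)).
Proof.
move=> [t1 t2]; split=> [x y|] /=.
- rewrite -comp_assoc -fmap_comp t1 fmap_comp comp_assoc.
  by rewrite comp_assoc (mphi_nat k).
- by rewrite -comp_assoc -fmap_comp t2.
Qed.

Lemma mon_assoc {F : Functor M N} {G : Functor N P} {H : Functor P Q}
    (d : MonData SM SN F) (e : MonData SN SP G) (k : MonData SP SQ H) :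
  IsMonoidal (compData (compData k e) d) (compData k (compData e d))
    (fun x => idm (H (G (F x)))).
Proof.
split=> [x y|] /=.
- by rewrite bmap_id comp_id_l comp_id_r fmap_comp !comp_assoc.
- by rewrite comp_id_l fmap_comp !comp_assoc.
Qed.

Lemma mon_assoc' {F : Functor M N} {G : Functor N P} {H : Functor P Q}
    (d : MonData SM SN F) (e : MonData SN SP G) (k : MonData SP SQ H) :
  IsMonoidal (compData k (compData e d)) (compData (compData k e) d)
    (fun x => idm (H (G (F x)))).
Proof.
split=> [x y|] /=.
- by rewrite bmap_id comp_id_l comp_id_r fmap_comp !comp_assoc.
- by rewrite comp_id_l fmap_comp !comp_assoc.
Qed.

Lemma mon_ext {F G : Functor M N} {d : MonData SM SN F}
    {e : MonData SM SN G} {s t : forall x, hom (F x) (G x)} :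
  (forall x, s x = t x) -> IsMonoidal d e s -> IsMonoidal d e t.
Proof.
by move=> st [s1 s2]; split=> [x y|]; rewrite -!st.
Qed.

End Monoidal.

Record Bicategory := {
  ob0 :> Type;
  Hom : ob0 -> ob0 -> Category;
  id1 : forall a, Hom a a;
  hcomp : forall {a b c}, Functor (Prod (Hom b c) (Hom a b)) (Hom a c);
  bassoc : forall {a b c d} (h : Hom c d) (g : Hom b c) (f : Hom a b),
    Iso (bob hcomp (bob hcomp h g) f) (bob hcomp h (bob hcomp g f));
  blun : forall {a b} (f : Hom a b), Iso (bob hcomp (id1 b) f) f;
  brun : forall {a b} (f : Hom a b), Iso (bob hcomp f (id1 a)) f;
  bassoc_nat : forall a b c d (h h' : Hom c d) (g g' : Hom b c)
      (f f' : Hom a b) (s : hom h h') (t : hom g g') (u : hom f f'),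
    bassoc h' g' f' ∘ bmap hcomp (bmap hcomp s t) u =
    bmap hcomp s (bmap hcomp t u) ∘ bassoc h g f;
  blun_nat : forall a b (f f' : Hom a b) (s : hom f f'),
    blun f' ∘ bmap hcomp (idm (id1 b)) s = s ∘ blun f;
  brun_nat : forall a b (f f' : Hom a b) (s : hom f f'),
    brun f' ∘ bmap hcomp s (idm (id1 a)) = s ∘ brun f;
  bpentagon : forall a b c d e (k : Hom d e) (h : Hom c d) (g : Hom b c)
      (f : Hom a b),
    bassoc k h (bob hcomp g f) ∘ bassoc (bob hcomp k h) g f =
    bmap hcomp (idm k) (bassoc h g f) ∘
      (bassoc k (bob hcomp h g) f ∘ bmap hcomp (bassoc k h g) (idm f));
  btriangle : forall a b c (g : Hom b c) (f : Hom a b),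
    bmap hcomp (idm g) (blun f) ∘ bassoc g (id1 b) f =
    bmap hcomp (brun g) (idm f)
}.
Arguments Hom {_} _ _.
Arguments id1 {_} _.
Arguments hcomp {_ _ _ _}.
Arguments bassoc {_ _ _ _ _} _ _ _.
Arguments blun {_ _ _} _.
Arguments brun {_ _ _} _.

Notation "g ⋆ f" := (bob hcomp g f)
  (at level 38, right associativity) : cat_scope.
Notation "s ⋆⋆ t" := (bmap hcomp s t)
  (at level 38, right associativity) : cat_scope.
Notation "f ◁ t" := (bmap hcomp (idm f) t)
  (at level 38, right associativity) : cat_scope.
Notation "s ▷ f" := (bmap hcomp s (idm f))
  (at level 38, right associativity) : cat_scope.

Definition IsStrict2Category (B : Bicategory) : Prop :=
  (forall (a b c d : B) (h : Hom c d) (g : Hom b c) (f : Hom a b),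
     IsIdentity (bassoc h g f)) /\
  (forall (a b : B) (f : Hom a b), IsIdentity (blun f)) /\
  (forall (a b : B) (f : Hom a b), IsIdentity (brun f)).

Definition Equivalent {B : Bicategory} (x y : B) : Prop :=
  exists (f : Hom x y) (g : Hom y x)
    (s : hom (id1 x) (g ⋆ f)) (t : hom (f ⋆ g) (id1 y)), IsIso s /\ IsIso t.

Section BicatCalculus.
Context {B : Bicategory}.

Lemma exch {a b c : B} {g g' : Hom b c} {f f' : Hom a b}
    (s : hom g g') (t : hom f f') :
  s ▷ f' ∘ g ◁ t = g' ◁ t ∘ s ▷ f.
Proof. by rewrite -bmap_lr -bmap_rl. Qed.

Lemma assoc_l {a b c d : B} (h : Hom c d) (g : Hom b c) {f f' : Hom a b}
    (t : hom f f') :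
  bassoc h g f' ∘ (h ⋆ g) ◁ t = h ◁ g ◁ t ∘ bassoc h g f.
Proof. by rewrite -bassoc_nat bmap_id. Qed.

Lemma assoc_m {a b c d : B} (h : Hom c d) {g g' : Hom b c} (f : Hom a b)
    (t : hom g g') :
  bassoc h g' f ∘ (h ◁ t) ▷ f = h ◁ (t ▷ f) ∘ bassoc h g f.
Proof. exact: bassoc_nat. Qed.

Lemma assoc_r {a b c d : B} {h h' : Hom c d} (g : Hom b c) (f : Hom a b)
    (t : hom h h') :
  bassoc h' g f ∘ (t ▷ g) ▷ f = t ▷ (g ⋆ f) ∘ bassoc h g f.
Proof. by rewrite bassoc_nat bmap_id. Qed.

Lemma iso_flip {M : Category} {x x' y y' : M} (i : Iso x y) (j : Iso x' y')
    (f : hom x x') (g : hom y y') :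
  j ∘ f = g ∘ i -> bwd j ∘ g = f ∘ bwd i.
Proof.
move=> e; apply: (iso_cancel_l (i := j)); apply: (iso_cancel_r (i := i)).
by rewrite -comp_assoc fwd_bwd comp_id_l !comp_assoc bwd_fwd comp_id_r e.
Qed.

Lemma assoc_l' {a b c d : B} (h : Hom c d) (g : Hom b c) {f f' : Hom a b}
    (t : hom f f') :
  bwd (bassoc h g f') ∘ h ◁ g ◁ t = (h ⋆ g) ◁ t ∘ bwd (bassoc h g f).
Proof. by apply: iso_flip; rewrite assoc_l. Qed.

Lemma assoc_m' {a b c d : B} (h : Hom c d) {g g' : Hom b c} (f : Hom a b)
    (t : hom g g') :
  bwd (bassoc h g' f) ∘ h ◁ (t ▷ f) = (h ◁ t) ▷ f ∘ bwd (bassoc h g f).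
Proof. by apply: iso_flip; rewrite assoc_m. Qed.

Lemma assoc_r' {a b c d : B} {h h' : Hom c d} (g : Hom b c) (f : Hom a b)
    (t : hom h h') :
  bwd (bassoc h' g f) ∘ t ▷ (g ⋆ f) = (t ▷ g) ▷ f ∘ bwd (bassoc h g f).
Proof. by apply: iso_flip; rewrite assoc_r. Qed.

Lemma lun_cancel {a b : B} {f f' : Hom a b} (s t : hom f f') :
  id1 b ◁ s = id1 b ◁ t -> s = t.
Proof.
move=> e; apply: (iso_cancel_r (i := blun f)).
by rewrite -!blun_nat e.
Qed.

Lemma run_cancel {a b : B} {f f' : Hom a b} (s t : hom f f') :
  s ▷ id1 a = t ▷ id1 a -> s = t.
Proof.
move=> e; apply: (iso_cancel_r (i := brun f)).
by rewrite -!brun_nat e.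
Qed.

Lemma lw_iso {a b c : B} (g : Hom b c) {f f' : Hom a b} (i : Iso f f') :
  g ◁ i ∘ g ◁ bwd i = idm _.
Proof. by rewrite -bmap_comp_l fwd_bwd bmap_id. Qed.

Lemma lw_iso' {a b c : B} (g : Hom b c) {f f' : Hom a b} (i : Iso f f') :
  g ◁ bwd i ∘ g ◁ i = idm _.
Proof. by rewrite -bmap_comp_l bwd_fwd bmap_id. Qed.

Lemma rw_iso {a b c : B} (f : Hom a b) {g g' : Hom b c} (i : Iso g g') :
  i ▷ f ∘ bwd i ▷ f = idm _.
Proof. by rewrite -bmap_comp_r fwd_bwd bmap_id. Qed.

Lemma rw_iso' {a b c : B} (f : Hom a b) {g g' : Hom b c} (i : Iso g g') :
  bwd i ▷ f ∘ i ▷ f = idm _.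
Proof. by rewrite -bmap_comp_r bwd_fwd bmap_id. Qed.

Lemma blun_comp {a b c : B} (g : Hom b c) (f : Hom a b) :
  blun (g ⋆ f) ∘ bassoc (id1 c) g f = blun g ▷ f.
Proof.
apply: lun_cancel; rewrite bmap_comp_l.
apply: (iso_cancel_r (i := isoComp (bassoc (id1 c) (id1 c ⋆ g) f)
  (bmapIso hcomp (bassoc (id1 c) (id1 c) g) (isoId f)))) => /=.
rewrite comp_assoc -bpentagon (assoc2 (btriangle _ _)) -assoc_r -btriangle.
by rewrite bmap_comp_r (assoc2 (assoc_m _ _ _)) !comp_assoc.
Qed.

Lemma brun_comp {a b c : B} (g : Hom b c) (f : Hom a b) :
  g ◁ brun f ∘ bassoc g f (id1 a) = brun (g ⋆ f).
Proof.
apply: run_cancel; rewrite bmap_comp_r.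
apply: (iso_cancel_l (i := bassoc g f (id1 a))).
rewrite (assoc2 (assoc_m _ _ _)) -(btriangle f) bmap_comp_l !comp_assoc.
by rewrite -bpentagon -comp_assoc -assoc_l comp_assoc btriangle.
Qed.

Lemma pent1 {a b c d e : B} (k : Hom d e) (h : Hom c d) (g : Hom b c)
    (f : Hom a b) :
  bwd (bassoc k h (g ⋆ f)) ∘ k ◁ bassoc h g f =
  bassoc (k ⋆ h) g f ∘ (bwd (bassoc k h g) ▷ f ∘ bwd (bassoc k (h ⋆ g) f)).
Proof.
apply: (iso_cancel_l (i := bassoc k h (g ⋆ f))).
rewrite (assoc2 (fwd_bwd _)) comp_id_l (assoc2 (bpentagon _ _ _ _)).
rewrite !comp_assoc (assoc2 (rw_iso _ _)) comp_id_l fwd_bwd.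
by rewrite comp_id_r.
Qed.

Lemma pent2 {a b c d e : B} (k : Hom d e) (h : Hom c d) (g : Hom b c)
    (f : Hom a b) :
  bwd (bassoc k (h ⋆ g) f) ∘ (k ◁ bwd (bassoc h g f) ∘ bassoc k h (g ⋆ f)) =
  bassoc k h g ▷ f ∘ bwd (bassoc (k ⋆ h) g f).
Proof.
apply: (iso_cancel_r (i := bassoc (k ⋆ h) g f)).
rewrite !comp_assoc bpentagon (assoc2 (lw_iso' _ _)) comp_id_l.
by rewrite (assoc2 (bwd_fwd _)) bwd_fwd comp_id_l comp_id_r.
Qed.

Lemma pent3 {a b c d e : B} (k : Hom d e) (h : Hom c d) (g : Hom b c)
    (f : Hom a b) :
  bwd (bassoc k h g) ▷ f ∘ (bwd (bassoc k (h ⋆ g) f) ∘ k ◁ bwd (bassoc h g f))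
  = bwd (bassoc (k ⋆ h) g f) ∘ bwd (bassoc k h (g ⋆ f)).
Proof.
apply: (iso_cancel_r (i := bassoc k h (g ⋆ f))).
rewrite !comp_assoc pent2 (assoc2 (rw_iso' _ _)) comp_id_l.
by rewrite bwd_fwd comp_id_r.
Qed.

Lemma blun_comp' {a b c : B} (g : Hom b c) (f : Hom a b) :
  blun g ▷ f ∘ bwd (bassoc (id1 c) g f) = blun (g ⋆ f).
Proof. by rewrite -blun_comp comp_assoc fwd_bwd comp_id_r. Qed.

Lemma brun_comp' {a b c : B} (g : Hom b c) (f : Hom a b) :
  bwd (bassoc g f (id1 a)) ∘ g ◁ bwd (brun f) = bwd (brun (g ⋆ f)).
Proof.
apply: (iso_cancel_r (i := brun (g ⋆ f))).
by rewrite bwd_fwd -brun_comp comp_assoc (assoc2 (lw_iso' _ _)) comp_id_l bwd_fwd.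
Qed.

Lemma pent4 {a b c d e : B} (k : Hom d e) (h : Hom c d) (g : Hom b c)
    (f : Hom a b) :
  k ◁ bwd (bassoc h g f) ∘ (bassoc k h (g ⋆ f) ∘ bassoc (k ⋆ h) g f) =
  bassoc k (h ⋆ g) f ∘ bassoc k h g ▷ f.
Proof. by rewrite bpentagon (assoc2 (lw_iso' _ _)) comp_id_l. Qed.

Lemma pent5 {a b c d e : B} (k : Hom d e) (h : Hom c d) (g : Hom b c)
    (f : Hom a b) :
  bassoc k h (g ⋆ f) ∘ (bassoc (k ⋆ h) g f ∘ bwd (bassoc k h g) ▷ f) =
  k ◁ bassoc h g f ∘ bassoc k (h ⋆ g) f.
Proof.
by rewrite (assoc2 (bpentagon _ _ _ _)) !comp_assoc rw_iso comp_id_r.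
Qed.

Lemma btriangle' {a b c : B} (g : Hom b c) (f : Hom a b) :
  brun g ▷ f ∘ bwd (bassoc g (id1 b) f) = g ◁ blun f.
Proof. by rewrite -btriangle comp_assoc fwd_bwd comp_id_r. Qed.

Lemma brun_comp'' {a b c : B} (g : Hom b c) (f : Hom a b) :
  brun (g ⋆ f) ∘ bwd (bassoc g f (id1 a)) = g ◁ brun f.
Proof. by rewrite -brun_comp comp_assoc fwd_bwd comp_id_r. Qed.

Lemma blun_id1 (a : B) : fwd (blun (id1 a)) = brun (id1 a).
Proof.
apply: run_cancel; rewrite -btriangle -blun_comp; congr (_ ∘ _).
by apply: (iso_cancel_l (i := blun (id1 a))); rewrite blun_nat.
Qed.

End BicatCalculus.

Record Pseudofunctor (B C : Bicategory) := {
  pob :> B -> C;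
  pmap : forall {a b}, Functor (Hom a b) (Hom (pob a) (pob b));
  pcomp : forall {a b c} (g : Hom b c) (f : Hom a b),
    Iso (pmap g ⋆ pmap f) (pmap (g ⋆ f));
  pid : forall a, Iso (id1 (pob a)) (pmap (id1 a));
  pcomp_nat : forall a b c (g g' : Hom b c) (f f' : Hom a b)
      (s : hom g g') (t : hom f f'),
    pcomp g' f' ∘ fmap pmap s ⋆⋆ fmap pmap t =
    fmap pmap (s ⋆⋆ t) ∘ pcomp g f;
  pcomp_assoc : forall a b c d (h : Hom c d) (g : Hom b c) (f : Hom a b),
    fmap pmap (bassoc h g f) ∘ (pcomp (h ⋆ g) f ∘ pcomp h g ▷ pmap f) =
    pcomp h (g ⋆ f) ∘ (pmap h ◁ pcomp g f ∘ bassoc (pmap h) (pmap g) (pmap f));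
  pcomp_lun : forall a b (f : Hom a b),
    fmap pmap (blun f) ∘ (pcomp (id1 b) f ∘ pid b ▷ pmap f) = blun (pmap f);
  pcomp_run : forall a b (f : Hom a b),
    fmap pmap (brun f) ∘ (pcomp f (id1 a) ∘ pmap f ◁ pid a) = brun (pmap f)
}.
Arguments pmap {_ _} _ {_ _}.
Arguments pcomp {_ _} _ {_ _ _} _ _.
Arguments pid {_ _} _ _.

Section PsFunFacts.
Context {B C : Bicategory} (F : Pseudofunctor B C).

Lemma pcomp_nat_l {a b c} (g : Hom b c) {f f' : Hom a b} (t : hom f f') :
  pcomp F g f' ∘ pmap F g ◁ fmap (pmap F) t =
  fmap (pmap F) (g ◁ t) ∘ pcomp F g f.
Proof. by rewrite -pcomp_nat fmap_id. Qed.

Lemma pcomp_nat_r {a b c} {g g' : Hom b c} (f : Hom a b) (t : hom g g') :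
  pcomp F g' f ∘ fmap (pmap F) t ▷ pmap F f =
  fmap (pmap F) (t ▷ f) ∘ pcomp F g f.
Proof. by rewrite -pcomp_nat fmap_id. Qed.
End PsFunFacts.

Definition idPs (B : Bicategory) : Pseudofunctor B B.
Proof.
refine (@Build_Pseudofunctor B B (fun a => a) (fun a b => idFun (Hom a b))
  (fun a b c g f => isoId (g ⋆ f)) (fun a => isoId (id1 a)) _ _ _ _).
all: abstract (by move=> *; rewrite /= ?bmap_id ?comp_id_r ?comp_id_l).
Defined.

Definition compPs {B C D : Bicategory} (G : Pseudofunctor C D)
    (F : Pseudofunctor B C) : Pseudofunctor B D.
Proof.
refine (@Build_Pseudofunctor B D (fun a => G (F a))
  (fun a b => compFun (pmap G) (pmap F))
  (fun a b c g f =>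
     isoComp (isoMap (pmap G) (pcomp F g f)) (pcomp G (pmap F g) (pmap F f)))
  (fun a => isoComp (isoMap (pmap G) (pid F a)) (pid G (F a))) _ _ _ _).
- abstract (move=> *;
  by rewrite /= comp_assoc pcomp_nat -!comp_assoc -!fmap_comp pcomp_nat).
- abstract (move=> a b c d h g f /=;
  rewrite bmap_comp_r bmap_comp_l !comp_assoc;
  rewrite (assoc2 (pcomp_nat_r G _ _)) (assoc2 (pcomp_nat_l G _ _)) !comp_assoc;
  rewrite -(pcomp_assoc G) -!comp_assoc -!fmap_comp;
  by rewrite !comp_assoc (pcomp_assoc F)).
- abstract (move=> a b f /=; rewrite bmap_comp_r !comp_assoc;
  rewrite (assoc2 (pcomp_nat_r G _ _)) -(pcomp_lun G) -(pcomp_lun F);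
  by rewrite !fmap_comp !comp_assoc).
- abstract (move=> a b f /=; rewrite bmap_comp_l !comp_assoc;
  rewrite (assoc2 (pcomp_nat_l G _ _)) -(pcomp_run G) -(pcomp_run F);
  by rewrite !fmap_comp !comp_assoc).
Defined.

Record PsTrans {B C : Bicategory} (F G : Pseudofunctor B C) := {
  tob :> forall a, Hom (F a) (G a);
  tmap : forall {a b} (f : Hom a b), Iso (pmap G f ⋆ tob a) (tob b ⋆ pmap F f);
  tmap_nat : forall a b (f f' : Hom a b) (s : hom f f'),
    tmap f' ∘ fmap (pmap G) s ▷ tob a = tob b ◁ fmap (pmap F) s ∘ tmap f;
  tmap_comp : forall a b c (g : Hom b c) (f : Hom a b),
    tmap (g ⋆ f) ∘ pcomp G g f ▷ tob a =
    tob c ◁ pcomp F g f ∘ (bassoc (tob c) (pmap F g) (pmap F f) ∘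
      (tmap g ▷ pmap F f ∘ (bwd (bassoc (pmap G g) (tob b) (pmap F f)) ∘
        (pmap G g ◁ tmap f ∘ bassoc (pmap G g) (pmap G f) (tob a)))));
  tmap_id : forall a,
    tmap (id1 a) ∘ pid G a ▷ tob a =
    tob a ◁ pid F a ∘ (bwd (brun (tob a)) ∘ blun (tob a))
}.
Arguments tmap {_ _ _ _} _ {_ _} _.

Record Modification {B C : Bicategory} {F G : Pseudofunctor B C}
    (s t : PsTrans F G) := {
  mob :> forall a, hom (s a) (t a);
  mob_nat : forall a b (f : Hom a b),
    tmap t f ∘ pmap G f ◁ mob a = mob b ▷ pmap F f ∘ tmap s f
}.

Lemma mod_eq {B C : Bicategory} {F G : Pseudofunctor B C} {s t : PsTrans F G}
    (m n : Modification s t) :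
  (forall a, m a = n a) -> m = n.
Proof.
case: m n => [m hm] [n hn] /= e.
have {}e : m = n by apply: functional_extensionality_dep.
case: n / e hn => hn; congr Build_Modification; exact: proof_irrelevance.
Qed.

Section IdTrans.
Context {B C : Bicategory} (F : Pseudofunctor B C).

Definition idTransMap {a b : B} (f : Hom a b) :
  Iso (pmap F f ⋆ id1 (F a)) (id1 (F b) ⋆ pmap F f) :=
  isoComp (isoInv (blun (pmap F f))) (brun (pmap F f)).

Lemma idTrans_nat {a b : B} {f f' : Hom a b} (s : hom f f') :
  idTransMap f' ∘ fmap (pmap F) s ▷ id1 (F a) =
  id1 (F b) ◁ fmap (pmap F) s ∘ idTransMap f.
Proof.
rewrite /=.
rewrite comp_assoc brun_nat.
apply: (iso_cancel_l (i := blun (pmap F f'))).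
rewrite (assoc2 (fwd_bwd _)) comp_id_l (assoc2 (blun_nat _)).
by rewrite comp_assoc (assoc2 (fwd_bwd _)) comp_id_l.
Qed.

Lemma idTrans_comp {a b c : B} (g : Hom b c) (f : Hom a b) :
  idTransMap (g ⋆ f) ∘ pcomp F g f ▷ id1 (F a) =
  id1 (F c) ◁ pcomp F g f ∘ (bassoc (id1 (F c)) (pmap F g) (pmap F f) ∘
    (idTransMap g ▷ pmap F f ∘
      (bwd (bassoc (pmap F g) (id1 (F b)) (pmap F f)) ∘
        (pmap F g ◁ idTransMap f ∘
          bassoc (pmap F g) (pmap F f) (id1 (F a)))))).
Proof.
rewrite /=.
rewrite comp_assoc brun_nat.
apply: (iso_cancel_l (i := blun (pmap F (g ⋆ f)))).
rewrite (assoc2 (fwd_bwd _)) comp_id_l (assoc2 (blun_nat _)).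
rewrite comp_assoc; congr (_ ∘ _).
rewrite (assoc2 (blun_comp _ _)) bmap_comp_r !comp_assoc.
rewrite (assoc2 (rw_iso _ _)) comp_id_l -btriangle.
rewrite bmap_comp_l !comp_assoc brun_comp.
by rewrite (assoc2 (fwd_bwd _)) comp_id_l (assoc2 (lw_iso _ _)) comp_id_l.
Qed.

Lemma idTrans_id (a : B) :
  idTransMap (id1 a) ∘ pid F a ▷ id1 (F a) =
  id1 (F a) ◁ pid F a ∘ (bwd (brun (id1 (F a))) ∘ blun (id1 (F a))).
Proof.
rewrite /=.
rewrite comp_assoc brun_nat.
apply: (iso_cancel_l (i := blun (pmap F (id1 a)))).
rewrite (assoc2 (fwd_bwd _)) comp_id_l (assoc2 (blun_nat _)).
by rewrite !blun_id1 bwd_fwd comp_id_r.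
Qed.

Definition idTrans : PsTrans F F :=
  @Build_PsTrans B C F F (fun a => id1 (F a)) (@idTransMap)
    (@idTrans_nat) (@idTrans_comp) idTrans_id.

End IdTrans.

Section CompTrans.
Context {B C : Bicategory} {F G H : Pseudofunctor B C}
  (t : PsTrans G H) (s : PsTrans F G).

Definition compTransMap {a b : B} (f : Hom a b) :
  Iso (pmap H f ⋆ (t a ⋆ s a)) ((t b ⋆ s b) ⋆ pmap F f) :=
  isoComp (isoInv (bassoc (t b) (s b) (pmap F f)))
  (isoComp (bmapIso hcomp (isoId (t b)) (tmap s f))
  (isoComp (bassoc (t b) (pmap G f) (s a))
  (isoComp (bmapIso hcomp (tmap t f) (isoId (s a)))
           (isoInv (bassoc (pmap H f) (t a) (s a)))))).

Lemma compTrans_nat {a b : B} {f f' : Hom a b} (x : hom f f') :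
  compTransMap f' ∘ fmap (pmap H) x ▷ (t a ⋆ s a) =
  (t b ⋆ s b) ◁ fmap (pmap F) x ∘ compTransMap f.
Proof.
rewrite /=.
rewrite !comp_assoc assoc_r' (assoc2 (eq_sym (bmap_comp_r _ _ _ _))) tmap_nat.
rewrite bmap_comp_r !comp_assoc (assoc2 (assoc_m _ _ _)) !comp_assoc.
rewrite (assoc2 (eq_sym (bmap_comp_l _ _ _ _))) tmap_nat bmap_comp_l !comp_assoc.
by rewrite (assoc2 (assoc_l' _ _ _)) !comp_assoc.
Qed.

Lemma compTrans_comp {a b c : B} (g : Hom b c) (f : Hom a b) :
  compTransMap (g ⋆ f) ∘ pcomp H g f ▷ (t a ⋆ s a) =
  (t c ⋆ s c) ◁ pcomp F g f ∘ (bassoc (t c ⋆ s c) (pmap F g) (pmap F f) ∘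
    (compTransMap g ▷ pmap F f ∘
      (bwd (bassoc (pmap H g) (t b ⋆ s b) (pmap F f)) ∘
        (pmap H g ◁ compTransMap f ∘
          bassoc (pmap H g) (pmap H f) (t a ⋆ s a))))).
Proof.
rewrite /=.
rewrite !comp_assoc assoc_r' (assoc2 (eq_sym (bmap_comp_r _ _ _ _))).
rewrite tmap_comp !bmap_comp_r !comp_assoc (assoc2 (assoc_m _ _ _)).
rewrite !comp_assoc (assoc2 (eq_sym (bmap_comp_l _ _ _ _))) tmap_comp.
rewrite !bmap_comp_l !comp_assoc (assoc2 (assoc_l' _ _ _)) !comp_assoc.
congr (_ ∘ _).
rewrite (assoc3 (eq_sym (bpentagon _ _ _ _))) !comp_assoc.
rewrite (assoc2 (assoc_r _ _ _)) !comp_assoc.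
rewrite (assoc2 (eq_sym (assoc_l _ _ _))) !comp_assoc.
rewrite (assoc2 (eq_sym (exch _ _))) !comp_assoc.
rewrite (assoc2 (pent1 _ _ _ _)) !comp_assoc.
rewrite (assoc2 (assoc_m' _ _ _)) !comp_assoc.
rewrite (assoc3 (pent2 _ _ _ _)) !comp_assoc.
rewrite (assoc2 (assoc_r' _ _ _)) !comp_assoc.
do 5 congr (_ ∘ _).
rewrite (assoc3 (pent3 _ _ _ _)) !comp_assoc; congr (_ ∘ _).
rewrite (assoc2 (assoc_l' _ _ _)) !comp_assoc; congr (_ ∘ _).
rewrite (assoc2 (pent1 _ _ _ _)) !comp_assoc.
by rewrite (assoc2 (assoc_m' _ _ _)) !comp_assoc pent2.
Qed.

Lemma compTrans_id (a : B) :
  compTransMap (id1 a) ∘ pid H a ▷ (t a ⋆ s a) =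
  (t a ⋆ s a) ◁ pid F a ∘ (bwd (brun (t a ⋆ s a)) ∘ blun (t a ⋆ s a)).
Proof.
rewrite /=.
rewrite !comp_assoc assoc_r' (assoc2 (eq_sym (bmap_comp_r _ _ _ _))).
rewrite tmap_id !bmap_comp_r !comp_assoc (assoc2 (assoc_m _ _ _)).
rewrite !comp_assoc (assoc2 (eq_sym (bmap_comp_l _ _ _ _))) tmap_id.
rewrite !bmap_comp_l !comp_assoc (assoc2 (assoc_l' _ _ _)) !comp_assoc.
congr (_ ∘ _).
rewrite (assoc2 (btriangle _ _)) (assoc2 (rw_iso _ _)) comp_id_l.
by rewrite blun_comp' (assoc2 (brun_comp' _ _)).
Qed.

Definition compTrans : PsTrans F H :=
  @Build_PsTrans B C F H (fun a => t a ⋆ s a) (@compTransMap)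
    (@compTrans_nat) (@compTrans_comp) compTrans_id.

End CompTrans.

Section Modifications.
Context {B C : Bicategory}.

Definition idMod {F G : Pseudofunctor B C} (s : PsTrans F G) :
  Modification s s.
Proof.
refine (@Build_Modification B C F G s s (fun a => idm (s a)) _).
abstract (by move=> a b f; rewrite !bmap_id comp_id_l comp_id_r).
Defined.

Definition vcompMod {F G : Pseudofunctor B C} {s t u : PsTrans F G}
    (n : Modification t u) (m : Modification s t) : Modification s u.
Proof.
refine (@Build_Modification B C F G s u (fun a => n a ∘ m a) _).
abstract (move=> a b f; rewrite bmap_comp_l -comp_assoc mob_nat comp_assoc;
  by rewrite mob_nat bmap_comp_r comp_assoc).
Defined.

Definition invMod {F G : Pseudofunctor B C} {s t : PsTrans F G}
    (m : forall a, Iso (s a) (t a))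
    (nat : forall a b (f : Hom a b),
      tmap t f ∘ pmap G f ◁ m a = m b ▷ pmap F f ∘ tmap s f) :
  Modification t s.
Proof.
refine (@Build_Modification B C F G t s (fun a => bwd (m a)) _).
abstract (move=> a b f;
  apply: (iso_cancel_l (i := bmapIso hcomp (m b) (isoId (pmap F f)))) => /=;
  rewrite (assoc2 (eq_sym (nat _ _ _))) comp_assoc lw_iso comp_id_r;
  by rewrite (assoc2 (rw_iso _ _)) comp_id_l).
Defined.

Lemma hcompMod_nat {F G H : Pseudofunctor B C} {t t' : PsTrans G H}
    {s s' : PsTrans F G} (m : Modification t t') (n : Modification s s')
    {a b : B} (f : Hom a b) :
  compTransMap t' s' f ∘ pmap H f ◁ (m a ⋆⋆ n a) =
  (m b ⋆⋆ n b) ▷ pmap F f ∘ compTransMap t s f.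
Proof.
rewrite /= (bmap_lr hcomp (m a)) (bmap_lr hcomp (m b)).
rewrite bmap_comp_l bmap_comp_r !comp_assoc.
rewrite (assoc2 (assoc_m' _ _ _)) !comp_assoc assoc_l'.
rewrite (assoc2 (eq_sym (bmap_comp_r _ _ _ _))) mob_nat bmap_comp_r.
rewrite !comp_assoc (assoc2 (assoc_r _ _ _)) !comp_assoc.
rewrite (assoc2 (eq_sym (exch _ _))) !comp_assoc.
rewrite (assoc2 (assoc_r' _ _ _)) !comp_assoc; congr (_ ∘ _).
rewrite (assoc2 (exch _ _)) !comp_assoc (assoc2 (assoc_l _ _ _)) !comp_assoc.
rewrite (assoc2 (eq_sym (bmap_comp_l _ _ _ _))) mob_nat bmap_comp_l.
by rewrite !comp_assoc (assoc2 (assoc_m' _ _ _)) !comp_assoc.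
Qed.

Definition hcompMod {F G H : Pseudofunctor B C} {t t' : PsTrans G H}
    {s s' : PsTrans F G} (m : Modification t t') (n : Modification s s') :
  Modification (compTrans t s) (compTrans t' s') :=
  @Build_Modification B C F H (compTrans t s) (compTrans t' s')
    (fun a => m a ⋆⋆ n a) (@hcompMod_nat _ _ _ _ _ _ _ m n).

Lemma assocMod_nat {F G H K : Pseudofunctor B C} (u : PsTrans H K)
    (t : PsTrans G H) (s : PsTrans F G) {a b : B} (f : Hom a b) :
  tmap (compTrans u (compTrans t s)) f ∘
    pmap K f ◁ bassoc (u a) (t a) (s a) =
  bassoc (u b) (t b) (s b) ▷ pmap F f ∘
    tmap (compTrans (compTrans u t) s) f.
Proof.
rewrite /= !bmap_comp_l !bmap_comp_r !comp_assoc pent1.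
rewrite (assoc2 (eq_sym (assoc_r _ _ _))) !comp_assoc.
rewrite (assoc3 (pent4 _ _ _ _)) !comp_assoc.
rewrite (assoc2 (eq_sym (assoc_m _ _ _))) !comp_assoc.
rewrite (assoc2 (eq_sym (pent2 _ _ _ _))) !comp_assoc.
rewrite (assoc2 (assoc_l _ _ _)) !comp_assoc.
by rewrite (assoc3 (pent5 _ _ _ _)) !comp_assoc.
Qed.

Lemma lunMod_nat {F G : Pseudofunctor B C} (s : PsTrans F G) {a b : B}
    (f : Hom a b) :
  tmap s f ∘ pmap G f ◁ blun (s a) =
  blun (s b) ▷ pmap F f ∘ tmap (compTrans (idTrans G) s) f.
Proof.
rewrite /= !bmap_comp_r !comp_assoc btriangle' (assoc2 (blun_comp' _ _)).
rewrite (assoc2 (blun_nat _)) !comp_assoc (assoc2 (blun_comp _ _)).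
by rewrite (assoc2 (rw_iso _ _)) comp_id_l.
Qed.

Lemma runMod_nat {F G : Pseudofunctor B C} (s : PsTrans F G) {a b : B}
    (f : Hom a b) :
  tmap s f ∘ pmap G f ◁ brun (s a) =
  brun (s b) ▷ pmap F f ∘ tmap (compTrans s (idTrans F)) f.
Proof.
rewrite /= !bmap_comp_l !comp_assoc (assoc2 (btriangle' _ _)).
rewrite (assoc2 (lw_iso _ _)) comp_id_l (assoc2 (brun_comp _ _)).
by rewrite (assoc2 (brun_nat _)) comp_assoc brun_comp''.
Qed.

End Modifications.

Section Adjoints.
Context {X Y Z : Category} {H : Functor (Prod X Y) Z} {SX : SymMon X}
  {SY : SymMon Y} {SZ : SymMon Z}.

(* A structure on x ↦ H(x, -) makes each functor H(-, y) symmetric strong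
   monoidal, and one on y ↦ H(-, y) does so for each H(x, -). *)
Definition strongR (d : SymStrong SX (pwSymMon Y SZ) (curryL H)) (y : Y) :
  SymStrong SX SZ (fixR H y).
Proof.
unshelve refine (@Build_SymStrong _ _ SX SZ (fixR H y)
  (@Build_MonData _ _ SX SZ (fixR H y) _ _) _ _ _ _ _).
- exact: (fun x x' => isoAt (mphi d x x') y).
- exact: (isoAt (mphi0 d) y).
- abstract (move=> x x' z z' f g;
    exact: (f_equal (fun s : NatTrans _ _ => s y) (mphi_nat d f g))).
- abstract (move=> x x' x'';
    exact: (f_equal (fun s : NatTrans _ _ => s y) (mphi_assoc d x x' x''))).
- abstract (move=> x;
    exact: (f_equal (fun s : NatTrans _ _ => s y) (mphi_lun d x))).
- abstract (move=> x;
    exact: (f_equal (fun s : NatTrans _ _ => s y) (mphi_run d x))).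
- abstract (move=> x x';
    exact: (f_equal (fun s : NatTrans _ _ => s y) (mphi_braid d x x'))).
Defined.

Definition strongL (d : SymStrong SY (pwSymMon X SZ) (curryR H)) (x : X) :
  SymStrong SY SZ (fixL H x).
Proof.
unshelve refine (@Build_SymStrong _ _ SY SZ (fixL H x)
  (@Build_MonData _ _ SY SZ (fixL H x) _ _) _ _ _ _ _).
- exact: (fun y y' => isoAt (mphi d y y') x).
- exact: (isoAt (mphi0 d) x).
- abstract (move=> y y' z z' f g;
    exact: (f_equal (fun s : NatTrans _ _ => s x) (mphi_nat d f g))).
- abstract (move=> y y' y'';
    exact: (f_equal (fun s : NatTrans _ _ => s x) (mphi_assoc d y y' y''))).
- abstract (move=> y;
    exact: (f_equal (fun s : NatTrans _ _ => s x) (mphi_lun d y))).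
- abstract (move=> y;
    exact: (f_equal (fun s : NatTrans _ _ => s x) (mphi_run d y))).
- abstract (move=> y y';
    exact: (f_equal (fun s : NatTrans _ _ => s x) (mphi_braid d y y'))).
Defined.

End Adjoints.

(* [distL] is the structure on f ↦ f ∘ -, i.e. (f ⊕ g) ∘ h ≅ f ∘ h ⊕ g ∘ h,
   and [distR] the one on f ↦ - ∘ f, i.e. f ∘ (g ⊕ h) ≅ f ∘ g ⊕ f ∘ h.  Hence
   [strongL (distR _ _ _) f] is the monoidal functor f ∘ - and
   [strongR (distL _ _ _) f] the monoidal functor - ∘ f. *)
Record SMCategory := {
  smc_bicat :> Bicategory;
  hmon : forall a b : smc_bicat, SymMon (Hom a b);
  distL : forall a b c : smc_bicat,
    SymStrong (hmon b c) (pwSymMon (Hom a b) (hmon a c)) (curryL hcomp);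
  distR : forall a b c : smc_bicat,
    SymStrong (hmon a b) (pwSymMon (Hom b c) (hmon a c)) (curryR hcomp);
  smc_sumL : forall (a b c : smc_bicat) (f g : Hom b c),
    IsMonoidal (sumData (strongL (distR a b c) f) (strongL (distR a b c) g))
      (strongL (distR a b c) (oplus (hmon b c) f g))
      (fun h => isoAt (mphi (distL a b c) f g) h);
  smc_sumR : forall (a b c : smc_bicat) (f g : Hom a b),
    IsMonoidal (sumData (strongR (distL a b c) f) (strongR (distL a b c) g))
      (strongR (distL a b c) (oplus (hmon a b) f g))
      (fun h => isoAt (mphi (distR a b c) f g) h);
  smc_zeroL : forall a b c : smc_bicat,
    IsMonoidal (constData (hmon a b) (hmon a c))
      (strongL (distR a b c) (munit (hmon b c)))
      (fun h => isoAt (mphi0 (distL a b c)) h);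
  smc_zeroR : forall a b c : smc_bicat,
    IsMonoidal (constData (hmon b c) (hmon a c))
      (strongR (distL a b c) (munit (hmon a b)))
      (fun h => isoAt (mphi0 (distR a b c)) h);
  smc_assocL : forall (a b c d : smc_bicat) (f : Hom c d) (g : Hom b c),
    IsMonoidal (strongL (distR a b d) (f ⋆ g))
      (compData (strongL (distR a c d) f) (strongL (distR a b c) g))
      (fun h => bassoc f g h);
  smc_assocR : forall (a b c d : smc_bicat) (f : Hom b c) (g : Hom a b),
    IsMonoidal
      (compData (strongR (distL a b d) g) (strongR (distL b c d) f))
      (strongR (distL a c d) (f ⋆ g))
      (fun h => bassoc h f g);
  smc_assocM : forall (a b c d : smc_bicat) (f : Hom c d) (g : Hom a b),
    IsMonoidal
      (compData (strongR (distL a b d) g) (strongL (distR b c d) f))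
      (compData (strongL (distR a c d) f) (strongR (distL a b c) g))
      (fun h => bassoc f h g);
  smc_run : forall a b : smc_bicat,
    IsMonoidal (strongR (distL a a b) (id1 a)) (idData (hmon a b))
      (fun h => brun h);
  smc_lun : forall a b : smc_bicat,
    IsMonoidal (strongL (distR a b b) (id1 b)) (idData (hmon a b))
      (fun h => blun h)
}.
Arguments hmon {_} _ _.
Arguments distL {_} _ _ _.
Arguments distR {_} _ _ _.

Notation lcomp f := (strongL (distR _ _ _) f).
Notation rcomp f := (strongR (distL _ _ _) f).

Record PCCategory := {
  pc_smc :> SMCategory;
  pc_strict : IsStrict2Category pc_smc;
  pc_perm : forall a b : pc_smc, IsPermutative (hmon a b);
  pc_distL : forall a b c : pc_smc, IsStrictMon (distL a b c);
  pc_distR : forall a b c : pc_smc, IsStrictlyUnital (distR a b c)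
}.

Record SMCFunctor (B C : SMCategory) := {
  smf_ps :> Pseudofunctor B C;
  smf_mon : forall a b : B,
    SymStrong (hmon a b) (hmon (smf_ps a) (smf_ps b)) (@pmap _ _ smf_ps a b);
  smf_compL : forall (a b c : B) (f : Hom a b),
    IsMonoidal (compData (rcomp (pmap smf_ps f)) (smf_mon b c))
      (compData (smf_mon a c) (rcomp f))
      (fun g => pcomp smf_ps g f);
  smf_compR : forall (a b c : B) (g : Hom b c),
    IsMonoidal (compData (lcomp (pmap smf_ps g)) (smf_mon a b))
      (compData (smf_mon a c) (lcomp g))
      (fun f => pcomp smf_ps g f)
}.
Arguments smf_mon {_ _} _ _ _.

Record MonTrans {B C : SMCategory} (F G : SMCFunctor B C) := {
  mt_ps :> PsTrans F G;
  mt_mon : forall a b : B,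
    IsMonoidal (compData (rcomp (mt_ps a)) (smf_mon G a b))
      (compData (lcomp (mt_ps b)) (smf_mon F a b))
      (fun f => tmap mt_ps f)
}.

Definition idSMC (B : SMCategory) : SMCFunctor B B.
Proof.
refine (@Build_SMCFunctor B B (idPs B) (fun a b => idStrong (hmon a b)) _ _).
all: abstract (by move=> a b c k; split=> *;
  rewrite /= ?bmap_id ?comp_id_l ?comp_id_r ?fmap_id ?bmap_id ?comp_id_l).
Defined.

Section CompSMC.
Context {B C D : SMCategory} (G : SMCFunctor C D) (F : SMCFunctor B C).

Lemma compSMC_compL (a b c : B) (f : Hom a b) :
  IsMonoidal
    (compData (rcomp (pmap G (pmap F f)))
      (compStrong (smf_mon G (F b) (F c)) (smf_mon F b c)))
    (compData (compStrong (smf_mon G (F a) (F c)) (smf_mon F a c)) (rcomp f))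
    (fun g => pcomp (compPs G F) g f).
Proof.
have st1 := mon_assoc' (smf_mon F b c) (smf_mon G (F b) (F c))
  (rcomp (pmap G (pmap F f))).
have st2 := mon_pre (smf_mon F b c)
  (smf_compL G (F c) (pmap F f)) (fun x y s => pcomp_nat_r G (pmap F f) s).
have st3 := mon_assoc (smf_mon F b c) (rcomp (pmap F f)) (smf_mon G (F a) (F c)).
have st4 := mon_post (smf_mon G (F a) (F c)) (smf_compL F c f).
have st5 := mon_assoc' (rcomp f) (smf_mon F a c) (smf_mon G (F a) (F c)).
apply: mon_ext (mon_comp st5 (mon_comp st4 (mon_comp st3 (mon_comp st2 st1)))).
by move=> g; rewrite /= !comp_id_l comp_id_r.
Qed.

Lemma compSMC_compR (a b c : B) (g : Hom b c) :
  IsMonoidal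
    (compData (lcomp (pmap G (pmap F g)))
      (compStrong (smf_mon G (F a) (F b)) (smf_mon F a b)))
    (compData (compStrong (smf_mon G (F a) (F c)) (smf_mon F a c)) (lcomp g))
    (fun f => pcomp (compPs G F) g f).
Proof.
have st1 := mon_assoc' (smf_mon F a b) (smf_mon G (F a) (F b))
  (lcomp (pmap G (pmap F g))).
have st2 := mon_pre (smf_mon F a b)
  (smf_compR G (F a) (pmap F g)) (fun x y s => pcomp_nat_l G (pmap F g) s).
have st3 := mon_assoc (smf_mon F a b) (lcomp (pmap F g)) (smf_mon G (F a) (F c)).
have st4 := mon_post (smf_mon G (F a) (F c)) (smf_compR F a g).
have st5 := mon_assoc' (lcomp g) (smf_mon F a c) (smf_mon G (F a) (F c)).
apply: mon_ext (mon_comp st5 (mon_comp st4 (mon_comp st3 (mon_comp st2 st1)))).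
by move=> f; rewrite /= !comp_id_l comp_id_r.
Qed.

Definition compSMC : SMCFunctor B D :=
  @Build_SMCFunctor B D (compPs G F)
    (fun a b => compStrong (smf_mon G (F a) (F b)) (smf_mon F a b))
    compSMC_compL compSMC_compR.

End CompSMC.

Lemma idMonTrans_mon {B C : SMCategory} (F : SMCFunctor B C) (a b : B) :
  IsMonoidal (compData (rcomp (id1 (F a))) (smf_mon F a b))
    (compData (lcomp (id1 (F b))) (smf_mon F a b))
    (fun f => tmap (idTrans F) f).
Proof.
have st1 := mon_pre (smf_mon F a b) (smc_run (F a) (F b))
  (fun x y s => brun_nat s).
have st2 := mon_pre (smf_mon F a b) (mon_inv (smc_lun (F a) (F b)))
  (fun x y s => iso_flip (blun_nat s)).
exact: mon_comp st2 st1.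
Qed.

Definition idMonTrans {B C : SMCategory} (F : SMCFunctor B C) : MonTrans F F :=
  @Build_MonTrans B C F F (idTrans F) (idMonTrans_mon F).

Lemma compMonTrans_mon {B C : SMCategory} {F G H : SMCFunctor B C}
    (t : MonTrans G H) (s : MonTrans F G) (a b : B) :
  IsMonoidal (compData (rcomp (t a ⋆ s a)) (smf_mon H a b))
    (compData (lcomp (t b ⋆ s b)) (smf_mon F a b))
    (fun f => tmap (compTrans t s) f).
Proof.
have st1 := mon_pre (smf_mon H a b)
  (mon_inv (smc_assocR (H b) (t a) (s a)))
  (fun x y u => iso_flip (assoc_r (t a) (s a) u)).
have st2 := mon_assoc (smf_mon H a b) (rcomp (t a)) (rcomp (s a)).
have st3 := mon_post (rcomp (s a)) (mt_mon t a b).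
have st4 := mon_assoc' (smf_mon G a b) (lcomp (t b)) (rcomp (s a)).
have st5 := mon_pre (smf_mon G a b) (smc_assocM (t b) (s a))
  (fun x y u => assoc_m (t b) (s a) u).
have st6 := mon_assoc (smf_mon G a b) (rcomp (s a)) (lcomp (t b)).
have st7 := mon_post (lcomp (t b)) (mt_mon s a b).
have st8 := mon_assoc' (smf_mon F a b) (lcomp (s b)) (lcomp (t b)).
have st9 := mon_pre (smf_mon F a b)
  (mon_inv (smc_assocL (F a) (t b) (s b)))
  (fun x y u => iso_flip (assoc_l (t b) (s b) u)).
apply: mon_ext (mon_comp st9 (mon_comp st8 (mon_comp st7 (mon_comp st6
  (mon_comp st5 (mon_comp st4 (mon_comp st3 (mon_comp st2 st1)))))))).
by move=> f; rewrite /= !comp_id_l.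
Qed.

Definition compMonTrans {B C : SMCategory} {F G H : SMCFunctor B C}
    (t : MonTrans G H) (s : MonTrans F G) : MonTrans F H :=
  @Build_MonTrans B C F H (compTrans t s) (compMonTrans_mon t s).

Section SMCCat.
Context (B C : SMCategory).

Definition TransCat (F G : SMCFunctor B C) : Category.
Proof.
refine (@Build_Category (MonTrans F G) (fun s t => Modification s t)
  (fun s => idMod s) (fun s t u n m => vcompMod n m) _ _ _).
- abstract (by move=> *; apply: mod_eq => a; exact: comp_id_l).
- abstract (by move=> *; apply: mod_eq => a; exact: comp_id_r).
- abstract (by move=> *; apply: mod_eq => a; exact: comp_assoc).
Defined.

Definition modIso {F G : SMCFunctor B C} {s t : TransCat F G}
    (m : forall a, Iso (mt_ps s a) (mt_ps t a))
    (nat : forall a b (f : Hom a b),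
      tmap (mt_ps t) f ∘ pmap G f ◁ m a =
      m b ▷ pmap F f ∘ tmap (mt_ps s) f) : Iso s t.
Proof.
refine (@Build_Iso (TransCat F G) s t
  (@Build_Modification _ _ _ _ _ _ (fun a => fwd (m a)) nat)
  (invMod nat) _ _).
- abstract (by apply: mod_eq => a; exact: bwd_fwd).
- abstract (by apply: mod_eq => a; exact: fwd_bwd).
Defined.

Definition hcompTrans (F G H : SMCFunctor B C) :
  Functor (Prod (TransCat G H) (TransCat F G)) (TransCat F H).
Proof.
refine (@Build_Functor (Prod (TransCat G H) (TransCat F G)) (TransCat F H)
  (fun p => compMonTrans (fst p) (snd p))
  (fun p q m => hcompMod (fst m) (snd m)) _ _).
- abstract (by move=> *; apply: mod_eq => a; exact: bmap_id).
- abstract (by move=> *; apply: mod_eq => a; exact: bmap_comp).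
Defined.

Definition SMCCat : Bicategory.
Proof.
unshelve refine (@Build_Bicategory (SMCFunctor B C) TransCat
  (fun F => idMonTrans F) hcompTrans _ _ _ _ _ _ _ _).
- move=> F G H K u t s.
  exact: (@modIso F K (compMonTrans (compMonTrans u t) s)
    (compMonTrans u (compMonTrans t s))
    (fun a => bassoc (mt_ps u a) (mt_ps t a) (mt_ps s a))
    (fun a b f => assocMod_nat u t s f)).
- move=> F G s.
  exact: (@modIso F G (compMonTrans (idMonTrans G) s) s
    (fun a => blun (mt_ps s a)) (fun a b f => lunMod_nat s f)).
- move=> F G s.
  exact: (@modIso F G (compMonTrans s (idMonTrans F)) s
    (fun a => brun (mt_ps s a)) (fun a b f => runMod_nat s f)).
- abstract (by move=> *; apply: mod_eq => a; exact: bassoc_nat).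
- abstract (by move=> *; apply: mod_eq => a; exact: blun_nat).
- abstract (by move=> *; apply: mod_eq => a; exact: brun_nat).
- abstract (by move=> *; apply: mod_eq => a; exact: bpentagon).
- abstract (by move=> *; apply: mod_eq => a; exact: btriangle).
Defined.

End SMCCat.

Definition IsBiequivalence {B C : SMCategory} (F : SMCFunctor B C) : Prop :=
  exists G : SMCFunctor C B,
    @Equivalent (SMCCat C C) (compSMC F G) (idSMC C) /\
    @Equivalent (SMCCat B B) (idSMC B) (compSMC G F).

(* Main.v *)
From Corelib Require Import ssreflect.
From Stdlib Require Import FunctionalExtensionality ProofIrrelevance List.
Require Import Defs.

Set Implicit Arguments.
Unset Strict Implicit.
Unset Printing Implicit Defensive.

Local Open Scope cat_scope.

(* A Cayley representation makes everything strict in one step.  A 1-cell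
   a -> b of the PC-category is an operator x: functions turning lists of
   1-cells c -> a into lists of 1-cells c -> b (a list standing for the sum of
   its entries), with isomorphisms x^ ∘ sum w ≅ sum (x w), where
   x^ = sum (x [1]).  Operators compose as functions and are added by
   concatenating values, so both operations are strictly associative and
   unital and (x + y) z = x z + y z, 0 z = 0; the equation x 0 = 0 is imposed.
   A 2-cell x -> y is a 2-cell x^ -> y^ of B, and all other structure is
   transported from B along x |-> x^.  Each axiom of the transported structure
   is a conjugate of an axiom of B, whatever isomorphisms are used for the
   transport; for the representing isomorphisms of operators the constraints
   that must be strict become identities. *)

(** * Transport of structure *)

(** Strictness is demanded of 1-cells, while [B] knows its 1-cells only up to isomorphism;
    composition of functions and concatenation of lists are chosen because their laws hold on the
    nose. The asymmetry of a PC-category is that of pointwise addition: (x + y) z evaluates both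
    summands at the same list, while x (y + z) applies x to a concatenation, so this distributivity
    stays an isomorphism. An equation between operators also requires their representing
    isomorphisms to agree, and here the coherence of [B] is spent: unit laws and pentagon for
    composition, bilinearity and conditions (1) and (2) for sums and zeros. The biequivalence asks
    little of operators: every 1-cell of [B] is isomorphic to some x^, so x |-> x^ is the identity
    on 0-cells, essentially surjective on 1-cells and bijective on 2-cells. *)

Section Cover.
Context {M : Category}.

(** A relation rather than the function [conjugate], so that the isomorphisms at the ends are free:
    a composite is covered by a composite once the isomorphisms in the middle agree by
    unification. *)
Definition cov {X Y x y : M} (i : Iso X x) (j : Iso Y y) (s : hom x y)
  (t : hom X Y) : Prop := s ∘ i = j ∘ t.

Definition conjugate {X Y x y : M} (i : Iso X x) (j : Iso Y y) (t : hom X Y) :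
  hom x y := j ∘ (t ∘ bwd i).

Lemma conjugate_id {X x : M} (i : Iso X x) : conjugate i i (idm X) = idm x.
Proof. by rewrite /conjugate comp_id_l fwd_bwd. Qed.

Lemma conjugate_comp {X Y Z x y z : M} (i : Iso X x) (j : Iso Y y) (k : Iso Z z)
    (t : hom Y Z) (s : hom X Y) :
  conjugate i k (t ∘ s) = conjugate j k t ∘ conjugate i j s.
Proof. by rewrite /conjugate !comp_assoc (assoc2 (bwd_fwd j)) comp_id_l. Qed.

Definition conjugateIso {X Y x y : M} (i : Iso X x) (j : Iso Y y) (t : Iso X Y) :
  Iso x y.
Proof.
refine {| fwd := conjugate i j t; bwd := conjugate j i (bwd t) |}.
- abstract (by rewrite -conjugate_comp bwd_fwd conjugate_id).
- abstract (by rewrite -conjugate_comp fwd_bwd conjugate_id).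
Defined.

Context {X Y Z x y z : M} {i : Iso X x} {j : Iso Y y} {k : Iso Z z}.

(** The transport principle: since [i] is invertible, an equation follows from the equation in [B]
    that covers it. *)
Lemma cov_eq {s s' : hom x y} {t t' : hom X Y} :
  cov i j s t -> cov i j s' t' -> t = t' -> s = s'.
Proof. by rewrite /cov => h h' e; apply: (iso_cancel_r (i := i)); rewrite h h' e. Qed.

Lemma cov_comp {s : hom x y} {s' : hom y z} {t t'} :
  cov i j s t -> cov j k s' t' -> cov i k (s' ∘ s) (t' ∘ t).
Proof. by rewrite /cov => h h'; rewrite comp_assoc h -comp_assoc h' comp_assoc. Qed.

Lemma cov_id : cov i i (idm x) (idm X).
Proof. by rewrite /cov comp_id_l comp_id_r. Qed.

Lemma cov_conjugate (t : hom X Y) : cov i j (conjugate i j t) t.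
Proof. by rewrite /cov /conjugate !comp_assoc bwd_fwd comp_id_r. Qed.

Lemma cov_refl (t : hom X Y) : cov (isoId X) (isoId Y) t t.
Proof. by rewrite /cov comp_id_l comp_id_r. Qed.

Lemma cov_bwd {s : Iso x y} {t : Iso X Y} :
  cov i j s t -> cov j i (bwd s) (bwd t).
Proof.
rewrite /cov => h; apply: (iso_cancel_l (i := s)).
rewrite -comp_assoc fwd_bwd comp_id_l -comp_assoc h comp_assoc fwd_bwd.
by rewrite comp_id_r.
Qed.

Lemma cov_nat {X' Y' : M} {i' : Iso X' X} {j' : Iso Y' Y} {s : hom x y}
    {t : hom X Y} {t' : hom X' Y'} :
  cov i j s t -> cov i' j' t t' -> cov (isoComp i i') (isoComp j j') s t'.
Proof. by rewrite /cov /= => h h'; rewrite -comp_assoc h !comp_assoc h'. Qed.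

(** Pastes the square defining a constraint to a naturality square of [B], and lets the resulting
    isomorphisms be stated in another form. *)
Lemma cov_at {X' Y' : M} {i' : Iso X' X} {j' : Iso Y' Y} {k' : Iso X' x}
    {l' : Iso Y' y} {s : hom x y} {t : hom X Y} {t' : hom X' Y'} :
  cov i j s t -> cov i' j' t t' -> i ∘ i' = k' -> j ∘ j' = l' -> cov k' l' s t'.
Proof. by move=> h h' e e'; move: (cov_nat h h'); rewrite /cov /= e e'. Qed.

End Cover.
Arguments conjugate : simpl never.
Arguments cov : simpl never.

Ltac cov_iso := rewrite /= ?bmap_id ?comp_id_r ?comp_assoc -?bmap_comp
  ?comp_id_l ?comp_id_r ?comp_assoc.

(** The full image of [ev] with codes kept as objects: equality of objects is equality in [E], so
    codes can obey strict laws that their values do not. *)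
Definition image {M : Category} {E : Type} (ev : E -> M) : Category.
Proof.
refine {| obj := E; hom := fun x y => hom (ev x) (ev y);
          idm := fun x => idm (ev x); comp := fun x y z g f => g ∘ f |}.
- abstract (by move=> *; exact: comp_id_l).
- abstract (by move=> *; exact: comp_id_r).
- abstract (by move=> *; exact: comp_assoc).
Defined.

Definition imageIso {M : Category} {E : Type} (ev : E -> M) {x y : E}
  (i : Iso (ev x) (ev y)) : @Iso (image ev) x y :=
  @Build_Iso (image ev) x y (fwd i) (bwd i) (bwd_fwd i) (fwd_bwd i).

Section TransportBi.
Context {X Y Z : Category} (H : Functor (Prod X Y) Z) {EX EY EZ : Type}
  {evX : EX -> X} {evY : EY -> Y} {evZ : EZ -> Z} {op : EX -> EY -> EZ}
  (phi : forall x y, Iso (bob H (evX x) (evY y)) (evZ (op x y))).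

Definition transportBi : Functor (Prod (image evX) (image evY)) (image evZ).
Proof.
refine (@Build_Functor (Prod (image evX) (image evY)) (image evZ)
  (fun p => op (fst p) (snd p))
  (fun p q f => conjugate (phi _ _) (phi _ _) (bmap H (fst f) (snd f))) _ _).
- abstract (by move=> p; rewrite /= bmap_id conjugate_id).
- abstract (by move=> p q r g f; rewrite /= bmap_comp (conjugate_comp _ (phi _ _))).
Defined.

Definition biIso {x y : _} {x' y' : _} (i : Iso x (evX x')) (j : Iso y (evY y')) :
  Iso (bob H x y) (evZ (op x' y')) := isoComp (phi x' y') (bmapIso H i j).

Lemma cov_bi {x0 x1 y0 y1} {X0 X1 Y0 Y1} {i : Iso X0 (evX x0)}
    {i' : Iso X1 (evX x1)} {j : Iso Y0 (evY y0)} {j' : Iso Y1 (evY y1)}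
    {s s' t t'} :
  cov i i' s t -> cov j j' s' t' ->
  cov (biIso i j) (biIso i' j')
    (conjugate (phi x0 y0) (phi x1 y1) (bmap H s s')) (bmap H t t').
Proof.
move=> h h'; apply: cov_nat; first exact: cov_conjugate.
by rewrite /cov /= -!bmap_comp h h'.
Qed.

End TransportBi.

Section TransportSym.
Context {M : Category} (S : SymMon M) {E : Type} {ev : E -> M} {e0 : E}
  {ea : E -> E -> E} (i0 : Iso (munit S) (ev e0))
  (ia : forall x y, Iso (oplus S (ev x) (ev y)) (ev (ea x y))).

(** Conjugation uses identities at the arguments; [cov_sassoc] passes to arbitrary isomorphisms by
    naturality. *)
Definition transAssoc (x y z : E) : Iso (ev (ea (ea x y) z)) (ev (ea x (ea y z))) :=
  conjugateIso (biIso ia (biIso ia (isoId _) (isoId _)) (isoId _))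
          (biIso ia (isoId _) (biIso ia (isoId _) (isoId _)))
          (sassoc S (ev x) (ev y) (ev z)).

Definition transLun (x : E) : Iso (ev (ea e0 x)) (ev x) :=
  conjugateIso (biIso ia i0 (isoId _)) (isoId _) (slun S (ev x)).

Definition transRun (x : E) : Iso (ev (ea x e0)) (ev x) :=
  conjugateIso (biIso ia (isoId _) i0) (isoId _) (srun S (ev x)).

Definition transBraid (x y : E) : hom (ev (ea x y)) (ev (ea y x)) :=
  conjugate (biIso ia (isoId _) (isoId _)) (biIso ia (isoId _) (isoId _))
    (sbraid S (ev x) (ev y)).

Context {X Y Z : M} {x y z : E} (i : Iso X (ev x)) (j : Iso Y (ev y))
  (k : Iso Z (ev z)).

Lemma cov_sassoc :
  cov (biIso ia (biIso ia i j) k) (biIso ia i (biIso ia j k))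
    (transAssoc x y z) (sassoc S X Y Z).
Proof.
apply: cov_at (cov_conjugate _) (sassoc_nat S i j k : cov (bmapIso _ (bmapIso _ i j) k)
  (bmapIso _ i (bmapIso _ j k)) _ _) _ _; by cov_iso.
Qed.

Lemma cov_slun : cov (biIso ia i0 i) i (transLun x) (slun S X).
Proof.
apply: cov_at (cov_conjugate _) (slun_nat S i : cov (bmapIso _ (isoId _) i) i _ _) _ _;
  by cov_iso.
Qed.

Lemma cov_srun : cov (biIso ia i i0) i (transRun x) (srun S X).
Proof.
apply: cov_at (cov_conjugate _) (srun_nat S i : cov (bmapIso _ i (isoId _)) i _ _) _ _;
  by cov_iso.
Qed.

Lemma cov_sbraid : cov (biIso ia i j) (biIso ia j i) (transBraid x y) (sbraid S X Y).
Proof.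
apply: cov_at (cov_conjugate _) (sbraid_nat S i j : cov (bmapIso _ i j) (bmapIso _ j i) _ _) _ _;
  by cov_iso.
Qed.

End TransportSym.
Opaque transAssoc transLun transRun transBraid.

(** * Distributivity and zero constraints in components *)

Section Distributivity.
Context {B : SMCategory}.

Definition dL {a b c : B} (f g : Hom b c) (h : Hom a b) :
  Iso (oplus (hmon a c) (f ⋆ h) (g ⋆ h)) (oplus (hmon b c) f g ⋆ h) :=
  isoAt (mphi (distL a b c) f g) h.

Definition dR {a b c : B} (f : Hom b c) (g h : Hom a b) :
  Iso (oplus (hmon a c) (f ⋆ g) (f ⋆ h)) (f ⋆ oplus (hmon a b) g h) :=
  isoAt (mphi (distR a b c) g h) f.

Definition zL {a b c : B} (h : Hom a b) :
  Iso (munit (hmon a c)) (munit (hmon b c) ⋆ h) := isoAt (mphi0 (distL a b c)) h.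

Definition zR {a b c : B} (f : Hom b c) :
  Iso (munit (hmon a c)) (f ⋆ munit (hmon a b)) := isoAt (mphi0 (distR a b c)) f.

(** The structure on f ↦ f ∘ - has two naturalities: in the summands, and in [h] because its
    constraint is a natural transformation. Splitting each horizontal composite applies them in
    turn. *)
Lemma dL_nat {a b c : B} {f f' g g' : Hom b c} {h h' : Hom a b}
    (s : hom f f') (t : hom g g') (u : hom h h') :
  dL f' g' h' ∘ oplusm (hmon a c) (s ⋆⋆ u) (t ⋆⋆ u) =
  oplusm (hmon b c) s t ⋆⋆ u ∘ dL f g h.
Proof.
rewrite (bmap_lr hcomp s) (bmap_lr hcomp t) (bmap_lr hcomp (oplusm _ s t)) bmap_comp.
have /= e := mphi_nat (rcomp h') s t.
have /= e' := nt_nat (fwd (mphi (distL a b c) f g)) u.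
by rewrite -comp_assoc [dL _ _ _ ∘ _]e !comp_assoc; exact: (f_equal (comp _) e').
Qed.

Lemma dR_nat {a b c : B} {f f' : Hom b c} {g g' h h' : Hom a b}
    (s : hom f f') (t : hom g g') (u : hom h h') :
  dR f' g' h' ∘ oplusm (hmon a c) (s ⋆⋆ t) (s ⋆⋆ u) =
  s ⋆⋆ oplusm (hmon a b) t u ∘ dR f g h.
Proof.
rewrite (bmap_rl hcomp s t) (bmap_rl hcomp s u) (bmap_rl hcomp s (oplusm _ t u)) bmap_comp.
have /= e := mphi_nat (lcomp f') t u.
have /= e' := nt_nat (fwd (mphi (distR a b c) g h)) s.
by rewrite -comp_assoc [dR _ _ _ ∘ _]e !comp_assoc; exact: (f_equal (comp _) e').
Qed.

Lemma zL_nat {a b c : B} {h h' : Hom a b} (u : hom h h') :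
  fwd (@zL a b c h') = munit (hmon b c) ◁ u ∘ zL h.
Proof. by have /= := nt_nat (fwd (mphi0 (distL a b c))) u; rewrite comp_id_r. Qed.

Lemma zR_nat {a b c : B} {f f' : Hom b c} (s : hom f f') :
  fwd (@zR a b c f') = s ▷ munit (hmon a b) ∘ zR f.
Proof. by have /= := nt_nat (fwd (mphi0 (distR a b c))) s; rewrite comp_id_r. Qed.

End Distributivity.

(** Codes for 1-cells with operations, compared with those of [B] by isomorphisms of which no
    compatibility is asked. [isoG] makes [ev] essentially surjective on each hom category. *)
Record presentation (B : SMCategory) := {
  cell : B -> B -> Type;
  ev : forall {a b}, cell a b -> Hom a b;
  cone : forall a, cell a a;
  cmul : forall {a b c}, cell b c -> cell a b -> cell a c;
  czero : forall a b, cell a b;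
  cadd : forall {a b}, cell a b -> cell a b -> cell a b;
  cgen : forall {a b}, Hom a b -> cell a b;
  iso1 : forall a, Iso (id1 a) (ev (cone a));
  isoM : forall {a b c} (x : cell b c) (y : cell a b),
    Iso (ev x ⋆ ev y) (ev (cmul x y));
  iso0 : forall a b, Iso (munit (hmon a b)) (ev (czero a b));
  isoA : forall {a b} (x y : cell a b),
    Iso (oplus (hmon a b) (ev x) (ev y)) (ev (cadd x y));
  isoG : forall {a b} (f : Hom a b), Iso f (ev (cgen f))
}.
Arguments cell {_} _ _ _.
Arguments ev {_ _ _ _} _.
Arguments cone {_} _ _.
Arguments czero {_} _ _ _.
Arguments iso1 {_} _ _.
Arguments iso0 {_} _ _ _.
Arguments isoM {_} _ {_ _ _} _ _.
Arguments isoA {_} _ {_ _} _ _.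
Arguments isoG {_} _ {_ _} _.
Arguments cgen {_} _ {_ _} _.

Section Transport.
Context {B : SMCategory} (P : presentation B).

Section Constraints.
Context {a b c d : B}.

Definition bassocP (h : cell P c d) (g : cell P b c) (f : cell P a b) :
  Iso (ev (cmul (cmul h g) f)) (ev (cmul h (cmul g f))) :=
  conjugateIso (biIso (isoM P) (biIso (isoM P) (isoId _) (isoId _)) (isoId _))
          (biIso (isoM P) (isoId _) (biIso (isoM P) (isoId _) (isoId _)))
          (bassoc (ev h) (ev g) (ev f)).

Definition blunP (f : cell P a b) : Iso (ev (cmul (cone P b) f)) (ev f) :=
  conjugateIso (biIso (isoM P) (iso1 P b) (isoId _)) (isoId _) (blun (ev f)).

Definition brunP (f : cell P a b) : Iso (ev (cmul f (cone P a))) (ev f) :=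
  conjugateIso (biIso (isoM P) (isoId _) (iso1 P a)) (isoId _) (brun (ev f)).

Definition dLP (f g : cell P b c) (h : cell P a b) :
  Iso (ev (cadd (cmul f h) (cmul g h))) (ev (cmul (cadd f g) h)) :=
  conjugateIso (biIso (isoA P) (biIso (isoM P) (isoId _) (isoId _))
                          (biIso (isoM P) (isoId _) (isoId _)))
          (biIso (isoM P) (biIso (isoA P) (isoId _) (isoId _)) (isoId _))
          (dL (ev f) (ev g) (ev h)).

Definition dRP (f : cell P b c) (g h : cell P a b) :
  Iso (ev (cadd (cmul f g) (cmul f h))) (ev (cmul f (cadd g h))) :=
  conjugateIso (biIso (isoA P) (biIso (isoM P) (isoId _) (isoId _))
                          (biIso (isoM P) (isoId _) (isoId _)))
          (biIso (isoM P) (isoId _) (biIso (isoA P) (isoId _) (isoId _)))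
          (dR (ev f) (ev g) (ev h)).

Definition zLP (h : cell P a b) : Iso (ev (czero P a c)) (ev (cmul (czero P b c) h)) :=
  conjugateIso (iso0 P a c) (biIso (isoM P) (iso0 P b c) (isoId _)) (zL (ev h)).

Definition zRP (f : cell P b c) : Iso (ev (czero P a c)) (ev (cmul f (czero P a b))) :=
  conjugateIso (iso0 P a c) (biIso (isoM P) (isoId _) (iso0 P a b)) (zR (ev f)).

End Constraints.

Section Coverings.
Context {a b c d : B} {f : cell P a b}.

Lemma cov_bassoc {h : cell P c d} {g : cell P b c} {X Y Z} (i : Iso X (ev h))
    (j : Iso Y (ev g)) (k : Iso Z (ev f)) :
  cov (biIso (isoM P) (biIso (isoM P) i j) k) (biIso (isoM P) i (biIso (isoM P) j k))
    (bassocP h g f) (bassoc X Y Z).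
Proof.
apply: cov_at (cov_conjugate _) (bassoc_nat i j k :
  cov (bmapIso _ (bmapIso _ i j) k) (bmapIso _ i (bmapIso _ j k)) _ _) _ _;
  by cov_iso.
Qed.

Lemma cov_blun {X} (i : Iso X (ev f)) :
  cov (biIso (isoM P) (iso1 P b) i) i (blunP f) (blun X).
Proof.
apply: cov_at (cov_conjugate _) (blun_nat i : cov (bmapIso _ (isoId _) i) i _ _) _ _;
  by cov_iso.
Qed.

Lemma cov_brun {X} (i : Iso X (ev f)) :
  cov (biIso (isoM P) i (iso1 P a)) i (brunP f) (brun X).
Proof.
apply: cov_at (cov_conjugate _) (brun_nat i : cov (bmapIso _ i (isoId _)) i _ _) _ _;
  by cov_iso.
Qed.

Lemma cov_dL {g h : cell P b c} {X Y Z} (i : Iso X (ev g))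
    (j : Iso Y (ev h)) (k : Iso Z (ev f)) :
  cov (biIso (isoA P) (biIso (isoM P) i k) (biIso (isoM P) j k))
    (biIso (isoM P) (biIso (isoA P) i j) k) (dLP g h f) (dL X Y Z).
Proof.
apply: cov_at (cov_conjugate _) (dL_nat i j k :
  cov (bmapIso _ (bmapIso _ i k) (bmapIso _ j k)) (bmapIso _ (bmapIso _ i j) k) _ _) _ _;
  by cov_iso.
Qed.

Lemma cov_dR {h : cell P b c} {g : cell P a b} {X Y Z} (i : Iso X (ev h))
    (j : Iso Y (ev f)) (k : Iso Z (ev g)) :
  cov (biIso (isoA P) (biIso (isoM P) i j) (biIso (isoM P) i k))
    (biIso (isoM P) i (biIso (isoA P) j k)) (dRP h f g) (dR X Y Z).
Proof.
apply: cov_at (cov_conjugate _) (dR_nat i j k :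
  cov (bmapIso _ (bmapIso _ i j) (bmapIso _ i k)) (bmapIso _ i (bmapIso _ j k)) _ _) _ _;
  by cov_iso.
Qed.

Lemma cov_zL {X} (i : Iso X (ev f)) :
  cov (iso0 P a c) (biIso (isoM P) (iso0 P b c) i) (zLP (c := c) f) (zL X).
Proof.
have e : cov (isoId _) (bmapIso hcomp (isoId _) i) (zL (c := c) (ev f)) (zL X).
  by rewrite /cov comp_id_r (zL_nat i).
by apply: cov_at (cov_conjugate _) e _ _; cov_iso.
Qed.

Lemma cov_zR {X} {g : cell P b c} (i : Iso X (ev g)) :
  cov (iso0 P a c) (biIso (isoM P) i (iso0 P a b)) (zRP (a := a) g) (zR X).
Proof.
have e : cov (isoId _) (bmapIso hcomp i (isoId _)) (zR (a := a) (ev g)) (zR X).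
  by rewrite /cov comp_id_r (zR_nat i).
by apply: cov_at (cov_conjugate _) e _ _; cov_iso.
Qed.

End Coverings.
End Transport.
Opaque bassocP blunP brunP dLP dRP zLP zRP.

Section Generators.
Context {B : SMCategory} (P : presentation B).

Definition genM {a b c : B} (g : Hom b c) (f : Hom a b) :
  Iso (ev (cmul (cgen P g) (cgen P f))) (ev (cgen P (g ⋆ f))) :=
  conjugateIso (biIso (isoM P) (isoG P g) (isoG P f)) (isoG P (g ⋆ f)) (isoId _).

Definition gen1 (a : B) : Iso (ev (cone P a)) (ev (cgen P (id1 a))) :=
  conjugateIso (iso1 P a) (isoG P (id1 a)) (isoId _).

Definition genA {a b : B} (g f : Hom a b) :
  Iso (ev (cadd (cgen P g) (cgen P f))) (ev (cgen P (oplus (hmon a b) g f))) :=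
  conjugateIso (biIso (isoA P) (isoG P g) (isoG P f)) (isoG P _) (isoId _).

Definition gen0 (a b : B) :
  Iso (ev (czero P a b)) (ev (cgen P (munit (hmon a b)))) :=
  conjugateIso (iso0 P a b) (isoG P _) (isoId _).

Lemma cov_genM {a b c : B} (g : Hom b c) (f : Hom a b) :
  cov (biIso (isoM P) (isoG P g) (isoG P f)) (isoG P (g ⋆ f)) (genM g f) (idm _).
Proof. exact: cov_conjugate. Qed.

Lemma cov_gen1 (a : B) : cov (iso1 P a) (isoG P (id1 a)) (gen1 a) (idm _).
Proof. exact: cov_conjugate. Qed.

Lemma cov_genA {a b : B} (g f : Hom a b) :
  cov (biIso (isoA P) (isoG P g) (isoG P f)) (isoG P _) (genA g f) (idm _).
Proof. exact: cov_conjugate. Qed.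

Lemma cov_gen0 (a b : B) : cov (iso0 P a b) (isoG P _) (gen0 a b) (idm _).
Proof. exact: cov_conjugate. Qed.

(* An opaque alias of [isoG], so that [cov_step] tells a 2-cell to be covered
   from a covering isomorphism. *)
Definition genU {a b : B} (x : cell P a b) : Iso (ev x) (ev (cgen P (ev x))) :=
  isoG P (ev x).

Lemma cov_genU {a b : B} {x : cell P a b} {X} (i : Iso X (ev x)) :
  cov i (isoG P (ev x)) (genU x) i.
Proof. by []. Qed.

End Generators.
Opaque genM gen1 genA gen0 genU.

Ltac cov_const := lazymatch goal with
| |- cov _ _ (fwd (transAssoc _ _ _ _)) _ => refine (cov_sassoc _ _ _ _)
| |- cov _ _ (fwd (transLun _ _ _)) _ => refine (cov_slun _ _ _)
| |- cov _ _ (fwd (transRun _ _ _)) _ => refine (cov_srun _ _ _)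
| |- cov _ _ (transBraid _ _ _) _ => refine (cov_sbraid _ _ _)
| |- cov _ _ (fwd (bassocP _ _ _)) _ => refine (cov_bassoc _ _ _)
| |- cov _ _ (fwd (blunP _)) _ => refine (cov_blun _)
| |- cov _ _ (fwd (brunP _)) _ => refine (cov_brun _)
| |- cov _ _ (fwd (dLP _ _ _)) _ => refine (cov_dL _ _ _)
| |- cov _ _ (fwd (dRP _ _ _)) _ => refine (cov_dR _ _ _)
| |- cov _ _ (fwd (zLP _)) _ => refine (cov_zL _)
| |- cov _ _ (fwd (zRP _)) _ => refine (cov_zR _)
| |- cov _ _ (fwd (genM _ _ _)) _ => refine (cov_genM _ _ _)
| |- cov _ _ (fwd (gen1 _ _)) _ => refine (cov_gen1 _ _)
| |- cov _ _ (fwd (genA _ _ _)) _ => refine (cov_genA _ _ _)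
| |- cov _ _ (fwd (gen0 _ _ _)) _ => refine (cov_gen0 _ _ _)
| |- _ => refine (cov_refl _)
end.

(** The shape of the 2-cell alone selects the rule, hence the opacity of the transported
    constraints: unfolded, they would be bare conjugates. *)
Ltac cov_step := lazymatch goal with
| |- cov _ _ (idm _) _ => refine cov_id
| |- cov _ _ (_ ∘ _) _ => apply: cov_comp
| |- cov _ _ (fwd (genU _)) _ => refine (cov_genU _)
| |- cov _ _ (conjugate (isoG _ _) (isoG _ _) _) _ => refine (cov_conjugate _)
| |- cov _ _ (conjugate (?p _ _) _ (bmap ?H _ _)) _ => apply: (cov_bi (H := H) p)
| |- cov _ _ (bwd _) _ => apply: cov_bwd
| |- cov _ _ _ _ => cov_const
end.

(* Coverings are inferred from right to left along a composite; those left
   undetermined belong to variables and are set to identities. *)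
Ltac cov_by e := rewrite /=;
  unshelve (apply: cov_eq; [ repeat cov_step | repeat cov_step | exact: e]);
  try exact: isoId.

Ltac cov_reduce := rewrite /=;
  unshelve (apply: cov_eq; [ repeat cov_step | repeat cov_step | idtac]);
  try exact: isoId; rewrite /= ?bmap_id ?comp_id_l ?comp_id_r.

Definition transportSymMon {M : Category} (S : SymMon M) {E : Type} {ev : E -> M}
  {e0 : E} {ea : E -> E -> E} (i0 : Iso (munit S) (ev e0))
  (ia : forall x y, Iso (oplus S (ev x) (ev y)) (ev (ea x y))) :
  SymMon (image ev).
Proof.
unshelve refine (@Build_SymMon (image ev) (transportBi ia) e0
  (fun x y z => imageIso (transAssoc ia x y z))
  (fun x => imageIso (transLun i0 ia x)) (fun x => imageIso (transRun i0 ia x))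
  (transBraid ia) _ _ _ _ _ _ _ _).
- abstract (move=> x x' y y' z z' f g h; cov_by (sassoc_nat S f g h)).
- abstract (move=> x x' f; cov_by (slun_nat S f)).
- abstract (move=> x x' f; cov_by (srun_nat S f)).
- abstract (move=> x x' y y' f g; cov_by (sbraid_nat S f g)).
- abstract (move=> w x y z; cov_by (spentagon S (ev w) (ev x) (ev y) (ev z))).
- abstract (move=> x y; cov_by (striangle S (ev x) (ev y))).
- abstract (move=> x y z; cov_by (shexagon S (ev x) (ev y) (ev z))).
- abstract (move=> x y; cov_by (ssym S (ev x) (ev y))).
Defined.

(** * The transported SMC-category *)

Section TransportSMC.
Context {B : SMCategory} (P : presentation B).

Definition transportBicat : Bicategory.
Proof.
unshelve refine (@Build_Bicategory B (fun a b => image (@ev B P a b)) (cone P)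
  (fun a b c => transportBi (@isoM B P a b c))
  (fun a b c d h g f => imageIso (bassocP h g f))
  (fun a b f => imageIso (blunP f)) (fun a b f => imageIso (brunP f)) _ _ _ _ _).
- abstract (move=> a b c d h h' g g' f f' s t u; cov_by (bassoc_nat s t u)).
- abstract (move=> a b f f' s; cov_by (blun_nat s)).
- abstract (move=> a b f f' s; cov_by (brun_nat s)).
- abstract (move=> a b c d e k h g f; cov_by (bpentagon (ev k) (ev h) (ev g) (ev f))).
- abstract (move=> a b c g f; cov_by (btriangle (ev g) (ev f))).
Defined.

Definition transportHmon (a b : transportBicat) : SymMon (Hom a b) :=
  transportSymMon (iso0 P a b) (@isoA B P a b).

Definition distLdata (a b c : transportBicat) :
  MonData (transportHmon b c) (pwSymMon (Hom a b) (transportHmon a c)) (curryL hcomp).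
Proof.
unshelve refine (@Build_MonData _ _ (transportHmon b c) (pwSymMon (Hom a b) (transportHmon a c))
  (curryL hcomp) _ _).
- move=> f g; refine (@natIso (Hom a b) (Hom a c)
    (pwob (transportHmon a c) (fixL (@hcomp transportBicat a b c) f)
      (fixL (@hcomp transportBicat a b c) g))
    (fixL (@hcomp transportBicat a b c) (cadd f g)) (fun h => imageIso (dLP f g h)) _).
  abstract (move=> h h' u; cov_by (nt_nat (fwd (mphi (distL a b c) (ev f) (ev g))) u)).
- refine (@natIso (Hom a b) (Hom a c) (constFun (Hom a b) (czero P a c : @Hom transportBicat a c))
    (fixL (@hcomp transportBicat a b c) (czero P b c)) (fun h => imageIso (zLP h)) _).
  abstract (move=> h h' u; cov_by (nt_nat (fwd (mphi0 (distL a b c))) u)).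
Defined.

Definition distRdata (a b c : transportBicat) :
  MonData (transportHmon a b) (pwSymMon (Hom b c) (transportHmon a c)) (curryR hcomp).
Proof.
unshelve refine (@Build_MonData _ _ (transportHmon a b) (pwSymMon (Hom b c) (transportHmon a c))
  (curryR hcomp) _ _).
- move=> f g; refine (@natIso (Hom b c) (Hom a c)
    (pwob (transportHmon a c) (fixR (@hcomp transportBicat a b c) f)
      (fixR (@hcomp transportBicat a b c) g))
    (fixR (@hcomp transportBicat a b c) (cadd f g)) (fun h => imageIso (dRP h f g)) _).
  abstract (move=> h h' u; cov_by (nt_nat (fwd (mphi (distR a b c) (ev f) (ev g))) u)).
- refine (@natIso (Hom b c) (Hom a c) (constFun (Hom b c) (czero P a c : @Hom transportBicat a c))
    (fixR (@hcomp transportBicat a b c) (czero P a b)) (fun h => imageIso (zRP h)) _).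
  abstract (move=> h h' u; cov_by (nt_nat (fwd (mphi0 (distR a b c))) u)).
Defined.

Definition distLP (a b c : transportBicat) :
  SymStrong (transportHmon b c) (pwSymMon (Hom a b) (transportHmon a c)) (curryL hcomp).
Proof.
refine {| mdata := distLdata a b c |}.
- abstract (move=> f f' g g' s t; apply: nt_eq => h; cov_by (mphi_nat (rcomp (ev h)) s t)).
- abstract (move=> x y z; apply: nt_eq => h;
    cov_by (mphi_assoc (rcomp (ev h)) (ev x) (ev y) (ev z))).
- abstract (move=> x; apply: nt_eq => h; cov_by (mphi_lun (rcomp (ev h)) (ev x))).
- abstract (move=> x; apply: nt_eq => h; cov_by (mphi_run (rcomp (ev h)) (ev x))).
- abstract (move=> x y; apply: nt_eq => h; cov_by (mphi_braid (rcomp (ev h)) (ev x) (ev y))).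
Defined.

Definition distRP (a b c : transportBicat) :
  SymStrong (transportHmon a b) (pwSymMon (Hom b c) (transportHmon a c)) (curryR hcomp).
Proof.
refine {| mdata := distRdata a b c |}.
- abstract (move=> f f' g g' s t; apply: nt_eq => h; cov_by (mphi_nat (lcomp (ev h)) s t)).
- abstract (move=> x y z; apply: nt_eq => h;
    cov_by (mphi_assoc (lcomp (ev h)) (ev x) (ev y) (ev z))).
- abstract (move=> x; apply: nt_eq => h; cov_by (mphi_lun (lcomp (ev h)) (ev x))).
- abstract (move=> x; apply: nt_eq => h; cov_by (mphi_run (lcomp (ev h)) (ev x))).
- abstract (move=> x y; apply: nt_eq => h; cov_by (mphi_braid (lcomp (ev h)) (ev x) (ev y))).
Defined.

Definition transportSMC : SMCategory.
Proof.
unshelve refine (@Build_SMCategory transportBicat transportHmon distLP distRP _ _ _ _ _ _ _ _ _).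
- abstract (move=> a b c f g; have [e e'] := smc_sumL a (ev f) (ev g);
    split=> [x y|]; [cov_by (e (ev x) (ev y)) | cov_by e']).
- abstract (move=> a b c f g; have [e e'] := smc_sumR c (ev f) (ev g);
    split=> [x y|]; [cov_by (e (ev x) (ev y)) | cov_by e']).
- abstract (move=> a b c; have [e e'] := smc_zeroL a b c;
    split=> [x y|]; [cov_by (e (ev x) (ev y)) | cov_by e']).
- abstract (move=> a b c; have [e e'] := smc_zeroR a b c;
    split=> [x y|]; [cov_by (e (ev x) (ev y)) | cov_by e']).
- abstract (move=> a b c d f g; have [e e'] := smc_assocL a (ev f) (ev g);
    split=> [x y|]; [cov_by (e (ev x) (ev y)) | cov_by e']).
- abstract (move=> a b c d f g; have [e e'] := smc_assocR d (ev f) (ev g);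
    split=> [x y|]; [cov_by (e (ev x) (ev y)) | cov_by e']).
- abstract (move=> a b c d f g; have [e e'] := smc_assocM (ev f) (ev g);
    split=> [x y|]; [cov_by (e (ev x) (ev y)) | cov_by e']).
- abstract (move=> a b; have [e e'] := smc_run a b;
    split=> [x y|]; [cov_by (e (ev x) (ev y)) | cov_by e']).
- abstract (move=> a b; have [e e'] := smc_lun a b;
    split=> [x y|]; [cov_by (e (ev x) (ev y)) | cov_by e']).
Defined.

End TransportSMC.

(** * Evaluation and generators as SMC-functors *)

Section Comparison.
Context {B : SMCategory} (P : presentation B).
Notation C := (transportSMC P).

Ltac cov_at_id h := have := h; rewrite /cov /= ?bmap_id ?comp_id_l ?comp_id_r ?comp_assoc;
  by move=> ->.

Definition evFun (a b : C) : Functor (Hom a b) (@Hom B a b) :=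
  @Build_Functor (@Hom C a b) (@Hom B a b) (@ev B P a b) (fun x y s => s)
    (fun x => eq_refl) (fun x y z g f => eq_refl).

(** Each coherence law is the covering of the corresponding constraint along identities. *)
Definition evPs : Pseudofunctor C B.
Proof.
unshelve refine (@Build_Pseudofunctor C B (fun a => a) evFun
  (fun a b c g f => isoM P g f) (fun a => iso1 P a) _ _ _ _).
- abstract (move=> a b c g g' f f' s t /=; exact: (eq_sym (cov_conjugate _))).
- abstract (move=> a b c d h g f;
    cov_at_id (cov_bassoc (isoId (ev h)) (isoId (ev g)) (isoId (ev f)))).
- abstract (move=> a b f; cov_at_id (cov_blun (isoId (ev f)))).
- abstract (move=> a b f; cov_at_id (cov_brun (isoId (ev f)))).
Defined.

Definition evMon (a b : C) : SymStrong (hmon a b) (@hmon B a b) (evFun a b).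
Proof.
unshelve refine (@Build_SymStrong _ _ (@hmon C a b) (@hmon B a b) (evFun a b)
  (@Build_MonData _ _ (@hmon C a b) (@hmon B a b) (evFun a b) (isoA P) (iso0 P a b)) _ _ _ _ _).
- abstract (move=> x x' y y' f g; exact: (eq_sym (cov_conjugate _))).
- abstract (move=> x y z;
    cov_at_id (cov_sassoc (isoA P) (isoId (ev x)) (isoId (ev y)) (isoId (ev z)))).
- abstract (move=> x; cov_at_id (cov_slun (iso0 P a b) (isoA P) (isoId (ev x)))).
- abstract (move=> x; cov_at_id (cov_srun (iso0 P a b) (isoA P) (isoId (ev x)))).
- abstract (move=> x y; cov_at_id (cov_sbraid (isoA P) (isoId (ev x)) (isoId (ev y)))).
Defined.

Definition evSMC : SMCFunctor C B.
Proof.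
refine (@Build_SMCFunctor C B evPs evMon _ _).
- abstract (move=> a b c f; split=> [x y|];
   [ cov_at_id (cov_dL (P := P) (isoId (ev x)) (isoId (ev y)) (isoId (ev f)))
   | cov_at_id (cov_zL (P := P) (c := c) (isoId (ev f))) ]).
- abstract (move=> a b c f; split=> [x y|];
   [ cov_at_id (cov_dR (P := P) (isoId (ev f)) (isoId (ev x)) (isoId (ev y)))
   | cov_at_id (cov_zR (P := P) (a := a) (isoId (ev f))) ]).
Defined.
End Comparison.

Section GeneratorFunctor.
Context {B : SMCategory} (P : presentation B).
Notation C := (transportSMC P).

Definition genFun (a b : B) : Functor (Hom a b) (@Hom C a b).
Proof.
refine (@Build_Functor (@Hom B a b) (@Hom C a b) (fun f => cgen P f)
  (fun f g s => conjugate (isoG P f) (isoG P g) s) _ _).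
- abstract (by move=> f; rewrite /= conjugate_id).
- abstract (by move=> f g h s t; rewrite /= (conjugate_comp _ (isoG P _))).
Defined.

(** The constraints [genM] and [gen1] are covered by identities, so the laws are covered by those of
    the identity functor of [B]. *)
Definition genPs : Pseudofunctor B C.
Proof.
unshelve refine (@Build_Pseudofunctor B C (fun a => a) genFun
  (fun a b c g f => imageIso (genM P g f)) (fun a => imageIso (gen1 P a)) _ _ _ _).
- abstract (move=> a b c g g' f f' s t; cov_by (pcomp_nat (idPs B) s t)).
- abstract (move=> a b c d h g f; cov_by (pcomp_assoc (idPs B) h g f)).
- abstract (move=> a b f; cov_by (pcomp_lun (idPs B) f)).
- abstract (move=> a b f; cov_by (pcomp_run (idPs B) f)).
Defined.

Definition genMon (a b : B) : SymStrong (@hmon B a b) (@hmon C a b) (genFun a b).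
Proof.
unshelve refine (@Build_SymStrong _ _ (@hmon B a b) (@hmon C a b) (genFun a b)
  (@Build_MonData _ _ (@hmon B a b) (@hmon C a b) (genFun a b)
    (fun f g => imageIso (genA P f g)) (imageIso (gen0 P a b))) _ _ _ _ _).
- abstract (move=> x x' y y' f g; cov_by (mphi_nat (idStrong (hmon a b)) f g)).
- abstract (move=> x y z; cov_by (mphi_assoc (idStrong (hmon a b)) x y z)).
- abstract (move=> x; cov_by (mphi_lun (idStrong (hmon a b)) x)).
- abstract (move=> x; cov_by (mphi_run (idStrong (hmon a b)) x)).
- abstract (move=> x y; cov_by (mphi_braid (idStrong (hmon a b)) x y)).
Defined.

Definition genSMC : SMCFunctor B C.
Proof.
refine (@Build_SMCFunctor B C genPs genMon _ _).
- abstract (move=> a b c f; have [e e'] := smf_compL (idSMC B) c f;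
    split=> [x y|]; [cov_by (e x y) | cov_by e']).
- abstract (move=> a b c f; have [e e'] := smf_compR (idSMC B) a f;
    split=> [x y|]; [cov_by (e x y) | cov_by e']).
Defined.

End GeneratorFunctor.

(** * Comparison of SMC-functors agreeing on 0-cells *)

Lemma iso_isIso {M : Category} {x y : M} (i : Iso x y) : IsIso i.
Proof. by exists (bwd i); rewrite bwd_fwd fwd_bwd. Qed.

(* An SMC-functor with its action on 0-cells split off, so that two functors
   with the same action on 0-cells can be compared without transport. *)
Record local_data {B C : SMCategory} (p : B -> C) := {
  loc_map : forall a b, Functor (Hom a b) (Hom (p a) (p b));
  loc_comp : forall {a b c} (g : Hom b c) (f : Hom a b),
    Iso (loc_map b c g ⋆ loc_map a b f) (loc_map a c (g ⋆ f));
  loc_id : forall a, Iso (id1 (p a)) (loc_map a a (id1 a));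
  loc_nat : forall a b c (g g' : Hom b c) (f f' : Hom a b)
      (s : hom g g') (t : hom f f'),
    loc_comp g' f' ∘ fmap (loc_map b c) s ⋆⋆ fmap (loc_map a b) t =
    fmap (loc_map a c) (s ⋆⋆ t) ∘ loc_comp g f;
  loc_assoc : forall a b c d (h : Hom c d) (g : Hom b c) (f : Hom a b),
    fmap (loc_map a d) (bassoc h g f) ∘
      (loc_comp (h ⋆ g) f ∘ loc_comp h g ▷ loc_map a b f) =
    loc_comp h (g ⋆ f) ∘ (loc_map c d h ◁ loc_comp g f ∘
      bassoc (loc_map c d h) (loc_map b c g) (loc_map a b f));
  loc_lun : forall a b (f : Hom a b),
    fmap (loc_map a b) (blun f) ∘
      (loc_comp (id1 b) f ∘ loc_id b ▷ loc_map a b f) = blun (loc_map a b f);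
  loc_run : forall a b (f : Hom a b),
    fmap (loc_map a b) (brun f) ∘
      (loc_comp f (id1 a) ∘ loc_map a b f ◁ loc_id a) = brun (loc_map a b f);
  loc_mon : forall a b, SymStrong (hmon a b) (hmon (p a) (p b)) (loc_map a b);
  loc_compL : forall (a b c : B) (f : Hom a b),
    IsMonoidal (compData (rcomp (loc_map a b f)) (loc_mon b c))
      (compData (loc_mon a c) (rcomp f)) (fun g => loc_comp g f);
  loc_compR : forall (a b c : B) (g : Hom b c),
    IsMonoidal (compData (lcomp (loc_map b c g)) (loc_mon a b))
      (compData (loc_mon a c) (lcomp g)) (fun f => loc_comp g f)
}.

Definition assemble {B C : SMCategory} {p : B -> C} (d : local_data p) :
  SMCFunctor B C :=
  @Build_SMCFunctor B C
    (@Build_Pseudofunctor B C p (loc_map d) (@loc_comp _ _ _ d) (loc_id d)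
       (@loc_nat _ _ _ d) (@loc_assoc _ _ _ d) (@loc_lun _ _ _ d) (@loc_run _ _ _ d))
    (loc_mon d) (@loc_compL _ _ _ d) (@loc_compR _ _ _ d).

Definition localize {B C : SMCategory} (F : SMCFunctor B C) : local_data F :=
  @Build_local_data B C F (@pmap _ _ F) (@pcomp _ _ F) (pid F) (@pcomp_nat _ _ F)
    (@pcomp_assoc _ _ F) (@pcomp_lun _ _ F) (@pcomp_run _ _ F) (smf_mon F)
    (@smf_compL _ _ F) (@smf_compR _ _ F).

Lemma assemble_localize {B C : SMCategory} (F : SMCFunctor B C) :
  assemble (localize F) = F.
Proof. by case: F => [[]]. Qed.

Section Icons.
Context {B C : SMCategory} {p : B -> C}.

(** A transformation whose components at 0-cells are identities, with these 1-cells left out so that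
    no unit constraint enters the laws. *)
Record icon (d e : local_data p) := {
  ic :> forall {a b} (f : Hom a b), Iso (loc_map d a b f) (loc_map e a b f);
  ic_nat : forall a b (f f' : Hom a b) (s : hom f f'),
    ic f' ∘ fmap (loc_map d a b) s = fmap (loc_map e a b) s ∘ ic f;
  ic_comp : forall a b c (g : Hom b c) (f : Hom a b),
    ic (g ⋆ f) ∘ loc_comp d g f = loc_comp e g f ∘ ic g ⋆⋆ ic f;
  ic_id : forall a, ic (id1 a) ∘ loc_id d a = loc_id e a;
  ic_mon : forall a b, IsMonoidal (loc_mon d a b) (loc_mon e a b) (fun f => ic f)
}.

Definition icon_inv {d e : local_data p} (w : icon d e) : icon e d.
Proof.
refine (@Build_icon e d (fun a b f => isoInv (w a b f)) _ _ _ _).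
- abstract (by move=> a b f f' s; apply: iso_flip; rewrite ic_nat).
- abstract (by move=> a b c g f;
    apply: (@iso_flip _ _ _ _ _ (bmapIso hcomp (w _ _ g) (w _ _ f)));
    rewrite /= ic_comp).
- abstract (by move=> a; rewrite -(ic_id w) /= (assoc2 (bwd_fwd _)) comp_id_l).
- abstract (by move=> a b; exact: mon_inv (ic_mon w a b)).
Defined.

Section Transformation.
Context {d e : local_data p} (w : icon e d).
Notation F := (assemble d).
Notation G := (assemble e).

(** The icon runs from [e] to [d] because the structure 2-cells of a transformation η from [F] to
    [G] go from G f ∘ η to η ∘ F f. *)
Definition iconMap {a b : B} (f : Hom a b) :
  Iso (loc_map e a b f ⋆ id1 (p a)) (id1 (p b) ⋆ loc_map d a b f) :=
  isoComp (idTransMap F f) (bmapIso hcomp (w a b f) (isoId (id1 (p a)))).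

Lemma iconMapE {a b : B} (f : Hom a b) :
  fwd (iconMap f) = idTransMap F f ∘ w a b f ▷ id1 (p a).
Proof. by []. Qed.

Lemma iconMap_nat {a b : B} (f f' : Hom a b) (s : hom f f') :
  iconMap f' ∘ fmap (pmap G) s ▷ id1 (p a) =
  id1 (p b) ◁ fmap (pmap F) s ∘ iconMap f.
Proof.
rewrite /= !comp_assoc -bmap_comp_r ic_nat bmap_comp_r.
have := idTrans_nat F s; rewrite /= !comp_assoc => e1.
by rewrite -!comp_assoc; congr (_ ∘ _); rewrite !comp_assoc.
Qed.

(** The identity transformation of [F] already satisfies the law; [ic_comp] and naturality slide the
    icon past it. *)
Lemma iconMap_comp {a b c : B} (g : Hom b c) (f : Hom a b) :
  iconMap (g ⋆ f) ∘ pcomp G g f ▷ id1 (p a) =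
  id1 (p c) ◁ pcomp F g f ∘ (bassoc (id1 (p c)) (pmap F g) (pmap F f) ∘
    (iconMap g ▷ pmap F f ∘ (bwd (bassoc (pmap G g) (id1 (p b)) (pmap F f)) ∘
      (pmap G g ◁ iconMap f ∘ bassoc (pmap G g) (pmap G f) (id1 (p a)))))).
Proof.
have e1 := idTrans_comp F g f.
rewrite !iconMapE comp_assoc -bmap_comp_r (ic_comp w) bmap_comp_r.
rewrite (assoc2 e1); move: {e1} (idTransMap F g) (idTransMap F f) => x y.
rewrite !comp_assoc; do 2 apply: (f_equal (comp _)).
rewrite bassoc_nat bmap_comp_r !comp_assoc; apply: (f_equal (comp _)).
rewrite (assoc2 (eq_sym (assoc_r' _ _ _))) !comp_assoc; apply: (f_equal (comp _)).
by rewrite -!comp_assoc -!bmap_comp !comp_id_l comp_id_r.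
Qed.

Lemma iconMap_id (a : B) :
  iconMap (id1 a) ∘ pid G a ▷ id1 (p a) =
  id1 (p a) ◁ pid F a ∘ (bwd (brun (id1 (p a))) ∘ blun (id1 (p a))).
Proof.
by rewrite -(idTrans_id F) iconMapE comp_assoc -bmap_comp_r ic_id.
Qed.

Definition iconTrans : MonTrans F G.
Proof.
refine (@Build_MonTrans B C F G (@Build_PsTrans B C F G (fun a => id1 (p a))
  (@iconMap) (@iconMap_nat) (@iconMap_comp) iconMap_id) _).
abstract (move=> a b; exact: (mon_comp (idMonTrans_mon F a b)
  (mon_post (rcomp (id1 (p a))) (ic_mon w a b)))).
Defined.

End Transformation.

(** Naturality of the unit constraints moves the icon to the other side, so that in a composite of
    two icon transformations [w] and [v] meet across one associator and cancel. *)
Lemma iconMap_slide {d e : local_data p} (w : icon e d) {a b : B} (f : Hom a b) :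
  fwd (iconMap w f) = id1 (p b) ◁ w a b f ∘ idTransMap (assemble e) f.
Proof.
rewrite /= comp_assoc (brun_nat (w a b f)) -[RHS]comp_assoc.
by rewrite -(iso_flip (blun_nat (w a b f))) comp_assoc.
Qed.

Section Inverses.
Context {d e : local_data p} (w : icon e d) (v : icon d e)
  (vw : forall a b (f : Hom a b), w a b f ∘ v a b f = idm _).

Lemma iconMap_inv {a b : B} (f : Hom a b) :
  fwd (tmap (compTrans (iconTrans v) (iconTrans w)) f) =
  tmap (compTrans (idTrans (assemble d)) (idTrans (assemble d))) f.
Proof.
have e1 := iconMapE w f; have e2 := iconMap_slide v f.
change (bwd (bassoc (id1 (p b)) (id1 (p b)) (loc_map d a b f)) ∘
  (id1 (p b) ◁ iconMap w f ∘ (bassoc (id1 (p b)) (loc_map e a b f) (id1 (p a)) ∘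
    (iconMap v f ▷ id1 (p a) ∘
      bwd (bassoc (loc_map d a b f) (id1 (p a)) (id1 (p a)))))) =
  bwd (bassoc (id1 (p b)) (id1 (p b)) (loc_map d a b f)) ∘
  (id1 (p b) ◁ idTransMap (assemble d) f ∘
    (bassoc (id1 (p b)) (loc_map d a b f) (id1 (p a)) ∘
    (idTransMap (assemble d) f ▷ id1 (p a) ∘
      bwd (bassoc (loc_map d a b f) (id1 (p a)) (id1 (p a))))))).
rewrite e1 e2; move: (idTransMap _ _) => x {e1 e2}.
rewrite bmap_comp_l bmap_comp_r !comp_assoc (assoc2 (assoc_m _ _ _)) !comp_assoc.
rewrite (assoc2 (eq_sym (bmap_comp_l _ _ (w a b f ▷ _) _))).
by rewrite -bmap_comp_r vw !bmap_id comp_id_l.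
Qed.

(** By [iconMap_inv] the structure 2-cells are those of the composite of two identity
    transformations, so the left unit modification serves. *)
Definition iconIso :
  @Iso (TransCat (assemble d) (assemble d))
    (compMonTrans (iconTrans v) (iconTrans w)) (idMonTrans (assemble d)).
Proof.
apply: (@modIso _ _ _ _ (compMonTrans (iconTrans v) (iconTrans w))
  (idMonTrans (assemble d)) (fun a => blun (id1 (p a)))).
abstract (move=> a b f; rewrite (iconMap_inv f);
  exact: (lunMod_nat (idTrans (assemble d)) f)).
Defined.

End Inverses.

Lemma icon_equivalent {d e : local_data p} (w : icon e d) :
  @Equivalent (SMCCat B C) (assemble d) (assemble e).
Proof.
pose h := iconIso (v := icon_inv w) (fun a b f => fwd_bwd (w a b f)).
pose k := iconIso (w := icon_inv w) (fun a b f => bwd_fwd (w a b f)).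
exists (iconTrans w), (iconTrans (icon_inv w)), (bwd h), (fwd k).
by split; [exact: (iso_isIso (isoInv h)) | exact: (iso_isIso k)].
Qed.

End Icons.

(** * Evaluation and generators are mutually inverse *)

Section Biequivalence.
Context {B : SMCategory} (P : presentation B).

(** The component at [x] is [isoG] at x^, read as a 2-cell of the transported category. *)
Definition genIcon : @icon (transportSMC P) (transportSMC P) (fun a => a)
  (localize (idSMC (transportSMC P))) (localize (compSMC (genSMC P) (evSMC P))).
Proof.
refine (@Build_icon _ _ _ (localize (idSMC (transportSMC P)))
  (localize (compSMC (genSMC P) (evSMC P)))
  (fun a b x => imageIso (genU x)) _ _ _ _).
- abstract (by move=> a b x y s; cov_reduce).
- abstract (by move=> a b c g f; cov_reduce).
- abstract (by move=> a; cov_reduce).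
- abstract (by move=> a b; split=> [x y|]; cov_reduce).
Defined.

Definition evIcon : @icon B B (fun a => a)
  (localize (compSMC (evSMC P) (genSMC P))) (localize (idSMC B)).
Proof.
refine (@Build_icon _ _ _ (localize (compSMC (evSMC P) (genSMC P)))
  (localize (idSMC B)) (fun a b f => isoInv (isoG P f)) _ _ _ _).
- abstract (by move=> a b x y s; rewrite /= /conjugate (assoc2 (bwd_fwd _)) comp_id_l).
- abstract (by move=> a b c g f; rewrite comp_id_l;
    apply: (iso_cancel_r (i := bmapIso hcomp (isoG P g) (isoG P f)));
    have := cov_genM P g f; rewrite /cov /= !comp_assoc -bmap_comp !bwd_fwd bmap_id => ->;
    rewrite comp_id_r bwd_fwd).
- abstract (move=> a; rewrite /=;
    have := cov_gen1 P a; rewrite /cov /= => ->; by rewrite comp_id_r bwd_fwd).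
- abstract (move=> a b; split=> [x y|]; [
  apply: (iso_cancel_r (i := bmapIso (tens _) (isoG P x) (isoG P y)));
  have := cov_genA P x y; rewrite /cov /= !comp_assoc -bmap_comp !bwd_fwd bmap_id => ->;
    by rewrite !comp_id_r bwd_fwd
  | have := cov_gen0 P a b; rewrite /cov /= => ->; by rewrite comp_id_r bwd_fwd ]).
Defined.

Lemma gen_biequivalence : IsBiequivalence (genSMC P).
Proof.
exists (evSMC P); split.
(* The composite acts as the identity on 0-cells by computation; as assembled local data it can be
   compared with the identity by an icon. *)
- rewrite -(assemble_localize (compSMC (genSMC P) (evSMC P))).
  rewrite -(assemble_localize (idSMC (transportSMC P))).
  exact: (icon_equivalent genIcon).
- rewrite -(assemble_localize (compSMC (evSMC P) (genSMC P))).
  rewrite -(assemble_localize (idSMC B)).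
  exact: (icon_equivalent evIcon).
Qed.

End Biequivalence.

(** * Operators *)

Lemma iso_eq {M : Category} {x y : M} (i j : Iso x y) : fwd i = fwd j -> i = j.
Proof.
move=> e; have e' : bwd i = bwd j.
  by apply: (iso_cancel_l (i := i)); rewrite fwd_bwd e fwd_bwd.
case: i j e e' => [f g h k] [f' g' h' k'] /= e e'; case: f' / e h' k'.
by case: g' / e' => h' k'; congr Build_Iso; exact: proof_irrelevance.
Qed.

Section EqHom.
Context {M : Category}.

Lemma eqHom_id {x : M} (e : x = x) : eqHom e = idm x.
Proof. by rewrite (proof_irrelevance _ e eq_refl). Qed.

Lemma eqHom_comp {x y z : M} (e : x = y) (e' : y = z) (k : x = z) :
  eqHom e' ∘ eqHom e = eqHom k.
Proof. by case: z / e' k; case: y / e => k; rewrite /= comp_id_l eqHom_id. Qed.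

End EqHom.

Lemma bmap_eqHom {X Y Z : Category} (H : Functor (Prod X Y) Z) {x x' : X} {y y' : Y}
    (e : x = x') (e' : y = y') (k : bob H x y = bob H x' y') :
  bmap H (eqHom e) (eqHom e') = eqHom k.
Proof. by case: x' / e k; case: y' / e' => k; rewrite /= eqHom_id bmap_id. Qed.

(* A monoidal category as a bicategory with one 0-cell, so that the unit
   coherences proved for bicategories apply to it. *)
Definition deloop {M : Category} (S : SymMon M) : Bicategory :=
  @Build_Bicategory unit (fun _ _ => M) (fun _ => munit S) (fun _ _ _ => tens S)
    (fun _ _ _ _ => sassoc S) (fun _ _ => slun S) (fun _ _ => srun S)
    (fun _ _ _ _ => sassoc_nat S) (fun _ _ => slun_nat S) (fun _ _ => srun_nat S)
    (fun _ _ _ _ _ => spentagon S) (fun _ _ _ => striangle S).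

(** * Sums of lists and concatenation *)

Section Sums.
Context {M : Category} (S : SymMon M).

(** A one-entry list has the value x ⊕ 0, not x; in exchange the recursion is uniform. This is the
    origin of [srun] at [id1 a] below. *)
Fixpoint sum (u : list M) : M :=
  match u with nil => munit S | x :: u => oplus S x (sum u) end.

Fixpoint sumD (u v : list M) : Iso (oplus S (sum u) (sum v)) (sum (u ++ v)) :=
  match u with
  | nil => slun S (sum v)
  | x :: u => isoComp (bmapIso (tens S) (isoId x) (sumD u v)) (sassoc S x (sum u) (sum v))
  end.

(** Induction on [u]: the base case is the unit coherence [blun_comp], the step is the pentagon. *)
Lemma sumD_assoc (u v w : list M) (e : sum ((u ++ v) ++ w) = sum (u ++ (v ++ w))) :
  eqHom e ∘ (sumD (u ++ v) w ∘ oplusm S (sumD u v) (idm (sum w))) =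
  sumD u (v ++ w) ∘ (oplusm S (idm (sum u)) (sumD v w) ∘
    sassoc S (sum u) (sum v) (sum w)).
Proof.
elim: u e => [|x u IH] e /=.
- rewrite eqHom_id comp_id_l (assoc2 (slun_nat _ _)) comp_assoc; congr (_ ∘ _).
  exact: (eq_sym (@blun_comp (deloop S) tt tt tt (sum v) (sum w))).
- have e0 : sum ((u ++ v) ++ w) = sum (u ++ (v ++ w)) by rewrite app_assoc.
  (* Writes [eqHom e] as the sum of the identity of [x] and [eqHom e0], to which the induction
     hypothesis applies. *)
  rewrite -(bmap_eqHom (H := tens S) eq_refl e0 e) /= bmap_comp_r !comp_assoc.
  rewrite (assoc2 (sassoc_nat S (idm x) (sumD u v) (idm (sum w)))) !comp_assoc.
  rewrite (assoc2 (eq_sym (bmap_comp_l _ _ _ _))) (assoc2 (eq_sym (bmap_comp_l _ _ _ _))).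
  rewrite !comp_assoc IH !bmap_comp_l !comp_assoc; congr (_ ∘ _).
  rewrite -(spentagon S x (sum u) (sum v) (sum w)).
  have := sassoc_nat S (idm x) (idm (sum u)) (sumD v w); rewrite bmap_id => h.
  by rewrite (assoc2 h) comp_assoc.
Qed.

(** The base case says that both unit constraints agree at the unit; the step is [brun_comp]. *)
Lemma sumD_nil_r (u : list M) (e : sum (u ++ nil) = sum u) :
  eqHom e ∘ sumD u nil = srun S (sum u).
Proof.
elim: u e => [|x u IH] e /=.
- rewrite eqHom_id comp_id_l; exact: (@blun_id1 (deloop S) tt).
- have e0 : sum (u ++ nil) = sum u by rewrite app_nil_r.
  rewrite -(bmap_eqHom (H := tens S) eq_refl e0 e) /=.
  rewrite (assoc2 (eq_sym (bmap_comp_l _ _ _ _))) IH.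
  exact: (@brun_comp (deloop S) tt tt tt x (sum u)).
Qed.

Lemma sumD_nat {u u' v v' : list M} (p : u = u') (q : v = v') (p' : sum u = sum u')
    (q' : sum v = sum v') (e : sum (u ++ v) = sum (u' ++ v')) :
  eqHom e ∘ sumD u v = sumD u' v' ∘ oplusm S (eqHom p') (eqHom q').
Proof.
case: u' / p p' e => p' e; case: v' / q q' e => q' e.
by rewrite !eqHom_id bmap_id comp_id_l comp_id_r.
Qed.

End Sums.

Notation osum w := (sum (hmon _ _) w).

(* [rep_one] and [rep_nil] are what makes the right unit constraint and the
   constraint x 0 ≅ 0 identities. *)
Record operator {B : SMCategory} (a b : B) := {
  act :> forall c : B, list (Hom c a) -> list (Hom c b);
  rep : forall c (w : list (Hom c a)),
    Iso (osum (act (id1 a :: nil)) ⋆ osum w) (osum (act w));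
  rep_one : fwd (rep (id1 a :: nil)) =
    brun (osum (act (id1 a :: nil))) ∘ osum (act (id1 a :: nil)) ◁ srun _ (id1 a);
  act_nil : forall c, act nil = nil :> list (Hom c b);
  rep_nil : forall c (e : osum (act nil) = munit (hmon c b)),
    eqHom e ∘ (rep nil ∘ zR (osum (act (id1 a :: nil)))) = idm _
}.
Arguments act {_ _ _} _ {_} _.
Arguments rep {_ _ _} _ {_} _.

(** * Unit, zero, composites, sums and generators among operators *)

Section Operators.
Context {B : SMCategory}.

Definition hat {a b : B} (x : operator a b) : Hom a b := osum (act x (id1 a :: nil)).

(** Inverses are unique and the equational fields are proof-irrelevant, so the action and the
    forward 2-cells decide. Where the actions agree by computation, [p] and [q] yield identities. *)
Lemma operator_eq {a b : B} (x y : operator a b)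
    (e : forall c (w : list (Hom c a)), act x w = act y w) :
  (forall c (w : list (Hom c a)) (p : hat x = hat y)
     (q : osum (act x w) = osum (act y w)),
     eqHom q ∘ rep x w = rep y w ∘ eqHom p ▷ osum w) -> x = y.
Proof.
case: x y e => [f r r1 f0 r0] [g s s1 g0 s0] /= e.
have {}e : f = g by do 2 apply: functional_extensionality_dep => ?.
case: g / e s s1 g0 s0 => s s1 g0 s0 h.
have {}h : r = s.
  apply: functional_extensionality_dep => c.
  apply: functional_extensionality_dep => w; apply: iso_eq.
  by have := h c w eq_refl eq_refl; rewrite !eqHom_id comp_id_l bmap_id comp_id_r.
case: s / h s1 s0 => s1 s0; congr Build_operator; exact: proof_irrelevance.
Qed.

(** An operator has no action on 2-cells; its naturality in the list is only along equalities. *)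
Lemma rep_nat {a b c : B} (x : operator a b) {w w' : list (Hom c a)} (e : w = w')
    (p : osum w = osum w') (q : osum (act x w) = osum (act x w')) :
  eqHom q ∘ rep x w = rep x w' ∘ hat x ◁ eqHom p.
Proof. by case: w' / e p q => p q; rewrite !eqHom_id bmap_id comp_id_l comp_id_r. Qed.

(** This and the next five lemmas are halves of conditions (1) and (2) in components; they yield
    [rep_one] and [rep_nil] for the operations on operators. *)
Lemma blun_zR (a b : B) : blun (munit (hmon a b)) ∘ zR (id1 b) = idm _.
Proof. by have [_] := smc_lun a b. Qed.

Lemma brun_zL (a b : B) : brun (munit (hmon a b)) ∘ zL (id1 a) = idm _.
Proof. by have [_] := smc_run a b. Qed.

Lemma zL_zR (a b c : B) :
  fwd (zL (munit (hmon a b))) = zR (a := a) (munit (hmon b c)).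
Proof. by have [_] := smc_zeroL a b c; rewrite /= comp_id_r. Qed.

Lemma bassoc_zR {a b c d : B} (f : Hom c d) (g : Hom b c) :
  bassoc f g (munit (hmon a b)) ∘ zR (f ⋆ g) = f ◁ zR g ∘ zR f.
Proof. by have [_] := smc_assocL a f g. Qed.

Lemma dL_zR {a b c : B} (f g : Hom b c) :
  dL f g (munit (hmon a b)) ∘ (oplusm (hmon a c) (zR f) (zR g) ∘
     bwd (slun (hmon a c) (munit (hmon a c)))) = zR (oplus (hmon b c) f g).
Proof. by have [_] := smc_sumL a f g. Qed.

Lemma brun_dL {a b : B} (f g : Hom a b) :
  brun (oplus (hmon a b) f g) ∘ dL f g (id1 a) = oplusm (hmon a b) (brun f) (brun g).
Proof. by have [e _] := smc_run a b; rewrite /= (e f g) /= !comp_id_l. Qed.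

(** The inverse of [rep x] replaces the hat of the composite by x^ ∘ y^; then [rep y] and [rep x]
    are applied in turn. *)
Definition repM {a b c d : B} (x : operator b c) (y : operator a b) (w : list (Hom d a)) :
  Iso (osum (act x (act y (id1 a :: nil))) ⋆ osum w) (osum (act x (act y w))) :=
  isoComp (rep x (act y w))
    (isoComp (bmapIso hcomp (isoId (hat x)) (rep y w))
    (isoComp (bassoc (hat x) (hat y) (osum w))
      (bmapIso hcomp (isoInv (rep x (act y (id1 a :: nil)))) (isoId (osum w))))).

(** [rep_one] turns [rep y] into unit constraints, and naturality of [brun] brings [rep x] next to
    its inverse. *)
Lemma repM_one {a b c : B} (x : operator b c) (y : operator a b) :
  fwd (repM x y (id1 a :: nil)) =
  brun (osum (act x (act y (id1 a :: nil)))) ∘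
    osum (act x (act y (id1 a :: nil))) ◁ srun _ (id1 a).
Proof.
rewrite /= rep_one bmap_comp_l !comp_assoc.
rewrite (assoc2 (eq_sym (assoc_l _ _ _))) comp_assoc (assoc2 (brun_comp _ _)).
rewrite -exch (assoc2 (brun_nat _)) !comp_assoc.
by rewrite (assoc2 (fwd_bwd _)) comp_id_l.
Qed.

Lemma repM_nil {a b c d : B} (x : operator b c) (y : operator a b)
    (e : osum (act x (act y nil)) = munit (hmon d c)) :
  eqHom e ∘ (repM x y nil ∘ zR (osum (act x (act y (id1 a :: nil))))) = idm _.
Proof.
have p : osum (act y (@nil (Hom d a))) = munit (hmon d b) by rewrite act_nil.
have q : osum (act x (act y (@nil (Hom d a)))) = osum (act x nil) by rewrite act_nil.
have e' : osum (act x (@nil (Hom d b))) = munit (hmon d c) by rewrite act_nil.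
(* [act y nil] is [nil] only propositionally; the equality is split at [act x nil], where [rep_nil]
   of [x] applies. *)
rewrite -(eqHom_comp q e' e) /= !comp_assoc (assoc2 (rep_nat (act_nil y d) p q)).
rewrite !comp_assoc -(zR_nat (bwd (rep x (act y (id1 a :: nil))))) bassoc_zR.
rewrite (assoc2 (eq_sym (bmap_comp_l _ _ _ _))) (assoc2 (eq_sym (bmap_comp_l _ _ _ _))).
rewrite comp_assoc rep_nil bmap_id comp_id_l; exact: rep_nil.
Qed.

Definition opM {a b c : B} (x : operator b c) (y : operator a b) : operator a c.
Proof.
refine (@Build_operator B a c (fun d w => act x (act y w)) (fun d => @repM a b c d x y)
  (repM_one x y) _ (fun d => @repM_nil a b c d x y)).
abstract (by move=> d; rewrite !act_nil).
Defined.

(** Its hat is 1 ⊕ 0; [rep_one] rests on the agreement of the two unit constraints at [id1 a]. *)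
Definition op1 (a : B) : operator a a.
Proof.
refine (@Build_operator B a a (fun c w => w)
  (fun c w => isoComp (blun (osum w)) (bmapIso hcomp (srun _ (id1 a)) (isoId (osum w))))
  _ _ _).
- abstract (apply: (iso_cancel_l (i := srun _ (id1 a)));
    rewrite /= -[LHS]comp_assoc -[RHS]comp_assoc -blun_nat -brun_nat !comp_assoc;
    by rewrite -exch blun_id1).
- abstract by [].
- abstract (by move=> c e; rewrite eqHom_id comp_id_l /= comp_assoc -zR_nat blun_zR).
Defined.

(** Here [rep_nil] says that [zL] and [zR] agree at the zero 1-cell, which is [zL_zR]. *)
Definition op0 (a b : B) : operator a b.
Proof.
refine (@Build_operator B a b (fun c w => nil) (fun c w => isoInv (zL (osum w))) _ _ _).
- abstract (apply: (iso_cancel_r (i := zL (osum (id1 a :: nil))));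
    rewrite /= comp_assoc -zL_nat brun_zL; exact: (bwd_fwd (zL _))).
- abstract by [].
- abstract (move=> c e; rewrite eqHom_id comp_id_l;
    exact: (eq_trans (f_equal (comp _) (eq_sym (zL_zR _ _ _))) (bwd_fwd (zL _)))).
Defined.

Definition repA {a b c : B} (x y : operator a b) (w : list (Hom c a)) :
  Iso (osum (act x (id1 a :: nil) ++ act y (id1 a :: nil)) ⋆ osum w)
    (osum (act x w ++ act y w)) :=
  isoComp (sumD _ (act x w) (act y w))
    (isoComp (bmapIso (tens _) (rep x w) (rep y w))
    (isoComp (isoInv (dL (hat x) (hat y) (osum w)))
      (bmapIso hcomp (isoInv (sumD _ (act x (id1 a :: nil)) (act y (id1 a :: nil))))
        (isoId (osum w))))).

Lemma repA_one {a b : B} (x y : operator a b) :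
  fwd (repA x y (id1 a :: nil)) =
  brun (osum (act x (id1 a :: nil) ++ act y (id1 a :: nil))) ∘
    osum (act x (id1 a :: nil) ++ act y (id1 a :: nil)) ◁ srun _ (id1 a).
Proof.
rewrite /= !rep_one bmap_comp !comp_assoc.
rewrite (assoc2 (eq_sym (iso_flip (dL_nat (idm (hat x)) (idm (hat y)) (srun _ (id1 a)))))).
rewrite bmap_id !comp_assoc -exch -brun_dL !comp_assoc (assoc2 (fwd_bwd (dL _ _ _))).
by rewrite comp_id_l (assoc2 (brun_nat _)) !comp_assoc (assoc2 (fwd_bwd _)) comp_id_l.
Qed.

Lemma repA_nil {a b c : B} (x y : operator a b)
    (e : osum (act x nil ++ act y nil) = munit (hmon c b)) :
  eqHom e ∘ (repA x y nil ∘ zR (osum (act x (id1 a :: nil) ++ act y (id1 a :: nil)))) =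
  idm _.
Proof.
have p : osum (act x (@nil (Hom c a))) = munit (hmon c b) by rewrite act_nil.
have q : osum (act y (@nil (Hom c a))) = munit (hmon c b) by rewrite act_nil.
have r : osum (act x (@nil (Hom c a)) ++ act y (@nil (Hom c a))) =
  osum (@nil (Hom c b) ++ nil) by rewrite !act_nil.
rewrite -(eqHom_comp r eq_refl e) /= comp_id_l !comp_assoc.
rewrite (assoc2 (sumD_nat (act_nil x c) (act_nil y c) p q r)) !comp_assoc.
rewrite -(zR_nat (bwd (sumD _ (act x (id1 a :: nil)) (act y (id1 a :: nil))))).
rewrite -dL_zR (assoc2 (bwd_fwd (dL _ _ _))) comp_id_l.
rewrite (assoc2 (eq_sym (bmap_comp _ _ _ _ _))) (assoc2 (eq_sym (bmap_comp _ _ _ _ _))).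
by rewrite !comp_assoc !rep_nil bmap_id comp_id_l fwd_bwd.
Qed.

Definition opA {a b : B} (x y : operator a b) : operator a b.
Proof.
refine (@Build_operator B a b (fun c w => act x w ++ act y w) (fun c => @repA a b c x y)
  (repA_one x y) _ (fun c => @repA_nil a b c x y)).
abstract (by move=> c; rewrite !act_nil).
Defined.

Definition hat_gen {a b : B} (f : Hom a b) :
  Iso (oplus (hmon a b) (f ⋆ osum (id1 a :: nil)) (munit _)) f :=
  isoComp (brun f) (isoComp (bmapIso hcomp (isoId f) (srun _ (id1 a)))
    (srun _ (f ⋆ osum (id1 a :: nil)))).

(** The empty list is set apart since [act_nil] asks for [nil], which a one-entry list holding f ∘ 0
    is not. *)
Definition actG {a b : B} (f : Hom a b) {c : B} (w : list (Hom c a)) : list (Hom c b) :=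
  match w with nil => nil | _ => (f ⋆ osum w) :: nil end.

Definition repG {a b : B} (f : Hom a b) {c : B} (w : list (Hom c a)) :
  Iso (oplus (hmon a b) (f ⋆ osum (id1 a :: nil)) (munit _) ⋆ osum w) (osum (actG f w)) :=
  match w with
  | nil => isoInv (zR (oplus (hmon a b) (f ⋆ osum (id1 a :: nil)) (munit _)))
  | x :: w => isoComp (isoInv (srun _ (f ⋆ osum (x :: w))))
      (bmapIso hcomp (hat_gen f) (isoId (osum (x :: w))))
  end.

Lemma repG_one {a b : B} (f : Hom a b)
    (h := oplus (hmon a b) (f ⋆ osum (id1 a :: nil)) (munit _)) :
  fwd (repG f (id1 a :: nil)) = brun h ∘ h ◁ srun _ (id1 a).
Proof.
apply: (iso_cancel_l (i := hat_gen f)).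
transitivity (brun f ∘ (f ◁ srun _ (id1 a) ∘ hat_gen f ▷ osum (id1 a :: nil))).
  by rewrite /= !comp_assoc (assoc2 (fwd_bwd _)) comp_id_l.
rewrite -[RHS]comp_assoc -(brun_nat (hat_gen f)) [RHS]comp_assoc; congr (_ ∘ _).
exact: (eq_sym (exch _ _)).
Qed.

Definition opG {a b : B} (f : Hom a b) : operator a b.
Proof.
refine (@Build_operator B a b (fun c => @actG a b f c) (fun c => @repG a b f c) _ _ _).
- exact: repG_one.
- abstract by [].
- abstract (move=> c e; rewrite eqHom_id comp_id_l; exact: (bwd_fwd (zR _))).
Defined.

End Operators.

(** * Strict laws for operators *)

Section StrictLaws.
Context {B : SMCategory}.

(** Associativity of the monoidal functor - ∘ k with the distributivity isomorphisms inverted, as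
    they occur in [repA]. *)
Lemma dL_assocV {a b c : B} (f g h : Hom b c) (k : Hom a b) :
  sassoc (hmon a c) (f ⋆ k) (g ⋆ k) (h ⋆ k) ∘
    (oplusm _ (bwd (dL f g k)) (idm (h ⋆ k)) ∘ bwd (dL (oplus _ f g) h k)) =
  oplusm _ (idm (f ⋆ k)) (bwd (dL g h k)) ∘
    (bwd (dL f (oplus _ g h) k) ∘ sassoc (hmon b c) f g h ▷ k).
Proof.
have e : sassoc (hmon b c) f g h ▷ k ∘
    (dL (oplus _ f g) h k ∘ oplusm _ (dL f g k) (idm (h ⋆ k))) =
  dL f (oplus _ g h) k ∘ (oplusm _ (idm (f ⋆ k)) (dL g h k) ∘
    sassoc (hmon a c) (f ⋆ k) (g ⋆ k) (h ⋆ k)) := mphi_assoc (rcomp k) f g h.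
pose i := isoComp (dL (oplus _ f g) h k) (bmapIso (tens _) (dL f g k) (isoId (h ⋆ k))).
pose j := isoComp (dL f (oplus _ g h) k) (bmapIso (tens _) (isoId (f ⋆ k)) (dL g h k)).
have := @iso_flip _ _ _ _ _ i j (sassoc (hmon a c) (f ⋆ k) (g ⋆ k) (h ⋆ k))
  (sassoc (hmon b c) f g h ▷ k).
rewrite /i /j /= !comp_assoc => -> //; exact: (eq_sym e).
Qed.

(** The binary half of condition (2) for (- ∘ h) ∘ k, in the same inverted form. *)
Lemma dL_bassocV {a b c d : B} (f g : Hom c d) (h : Hom b c) (k : Hom a b) :
  bwd (dL f g (h ⋆ k)) ∘ bassoc (oplus (hmon c d) f g) h k =
  oplusm (hmon a d) (bassoc f h k) (bassoc g h k) ∘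
    (bwd (dL (f ⋆ h) (g ⋆ h) k) ∘ bwd (dL f g h) ▷ k).
Proof.
have [e _] := smc_assocR d h k.
have {}e : bassoc (oplus (hmon c d) f g) h k ∘ (dL f g h ▷ k ∘ dL (f ⋆ h) (g ⋆ h) k) =
  dL f g (h ⋆ k) ∘ oplusm (hmon a d) (bassoc f h k) (bassoc g h k) := e f g.
exact: (@iso_flip _ _ _ _ _ (isoComp (bmapIso hcomp (dL f g h) (isoId k))
  (dL (f ⋆ h) (g ⋆ h) k)) (dL f g (h ⋆ k)) _ _ (eq_sym e)).
Qed.

Lemma bmap_mid_l {X Y Z : Category} (H : Functor (Prod X Y) Z) {x0 x1 x2 x3 : X}
    {y y' : Y} (f : hom x2 x3) (g : hom x1 x2) (h : hom x0 x1) (k : hom y y') :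
  bmap H (f ∘ (g ∘ h)) k = bmap H f (idm y') ∘ (bmap H g k ∘ bmap H h (idm y)).
Proof. by rewrite -!bmap_comp comp_id_l comp_id_r. Qed.

Lemma bmap_mid_r {X Y Z : Category} (H : Functor (Prod X Y) Z) {x0 x1 x2 x3 : Y}
    {y y' : X} (f : hom x2 x3) (g : hom x1 x2) (h : hom x0 x1) (k : hom y y') :
  bmap H k (f ∘ (g ∘ h)) = bmap H (idm y') f ∘ (bmap H k g ∘ bmap H (idm y) h).
Proof. by rewrite -!bmap_comp comp_id_l comp_id_r. Qed.

(** Precomposition with [rep x] clears the inverse in [repM]; the laws below are proved by
    cancelling such isomorphisms on the right. *)
Lemma repME {a b c d : B} (x : operator b c) (y : operator a b) (w : list (Hom d a)) :
  repM x y w ∘ rep x (act y (id1 a :: nil)) ▷ osum w =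
  rep x (act y w) ∘ (hat x ◁ rep y w ∘ bassoc (hat x) (hat y) (osum w)).
Proof. by rewrite /= !comp_assoc rw_iso' comp_id_r. Qed.

Lemma repAE {a b c : B} (x y : operator a b) (w : list (Hom c a)) :
  repA x y w ∘ sumD _ (act x (id1 a :: nil)) (act y (id1 a :: nil)) ▷ osum w =
  sumD _ (act x w) (act y w) ∘
    (oplusm _ (rep x w) (rep y w) ∘ bwd (dL (hat x) (hat y) (osum w))).
Proof. by rewrite /= !comp_assoc rw_iso' comp_id_r. Qed.

Lemma repA_dL {a b c : B} (x y : operator a b) (w : list (Hom c a)) :
  repA x y w ∘ (sumD _ (act x (id1 a :: nil)) (act y (id1 a :: nil)) ▷ osum w ∘
    dL (hat x) (hat y) (osum w)) =
  sumD _ (act x w) (act y w) ∘ oplusm _ (rep x w) (rep y w).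
Proof. by rewrite -comp_assoc repAE !comp_assoc bwd_fwd comp_id_r. Qed.

Lemma opM_assoc {a b c d : B} (x : operator c d) (y : operator b c) (z : operator a b) :
  opM (opM x y) z = opM x (opM y z).
Proof.
apply: (@operator_eq _ _ _ (opM (opM x y) z) (opM x (opM y z)) (fun _ _ => eq_refl)).
move=> e w p q; rewrite !eqHom_id bmap_id comp_id_l comp_id_r.
pose z1 := act z (id1 a :: nil); pose t := rep x (act y (id1 b :: nil)).
apply: (iso_cancel_r (i := bmapIso hcomp (repM x y z1) (isoId (osum w)))).
apply: (iso_cancel_r (i := bmapIso hcomp (bmapIso hcomp t (isoId (hat z))) (isoId (osum w)))).
(* Both bracketings reduce to this composite, the second one through the pentagon. *)
transitivity (rep x (act y (act z w)) ∘ (hat x ◁ rep y (act z w) ∘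
  (hat x ◁ hat y ◁ rep z w ∘ (bassoc (hat x) (hat y) (hat z ⋆ osum w) ∘
    bassoc (hat x ⋆ hat y) (hat z) (osum w))))).
- change (repM (opM x y) z w ∘ rep (opM x y) z1 ▷ osum w ∘ (t ▷ hat z) ▷ osum w =
    rep x (act y (act z w)) ∘ (hat x ◁ rep y (act z w) ∘
    (hat x ◁ hat y ◁ rep z w ∘ (bassoc (hat x) (hat y) (hat z ⋆ osum w) ∘
    bassoc (hat x ⋆ hat y) (hat z) (osum w))))).
  rewrite repME.
  have : rep (opM x y) (act z w) ∘ t ▷ osum (act z w) = _ := repME x y (act z w).
  (* Generalized, since rewriting would otherwise unfold it. *)
  move: (rep (opM x y) (act z w)) => R h.
  rewrite !comp_assoc assoc_r (assoc2 (eq_sym (exch _ _))) !comp_assoc (assoc2 h) !comp_assoc.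
  by rewrite (assoc2 (assoc_l _ _ _)) !comp_assoc.
- change (rep x (act y (act z w)) ∘ (hat x ◁ rep y (act z w) ∘
    (hat x ◁ hat y ◁ rep z w ∘ (bassoc (hat x) (hat y) (hat z ⋆ osum w) ∘
    bassoc (hat x ⋆ hat y) (hat z) (osum w)))) =
    repM x (opM y z) w ∘ repM x y z1 ▷ osum w ∘ (t ▷ hat z) ▷ osum w).
  rewrite [RHS]comp_assoc -bmap_comp_r (repME x y z1) !bmap_comp_r.
  have h0 : repM x (opM y z) w ∘ rep x (act y z1) ▷ osum w = _ := repME x (opM y z) w.
  rewrite -[RHS]comp_assoc h0 {h0}.
  have : rep (opM y z) w ∘ rep y z1 ▷ osum w = _ := repME y z w.
  move: (rep (opM y z) w) => R h.
  rewrite !comp_assoc (assoc2 (assoc_m _ _ _)) !comp_assoc.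
  have := f_equal (bmap hcomp (idm (hat x))) h; rewrite !bmap_comp_l => h'.
  rewrite (assoc2 h') !comp_assoc.
  by rewrite bpentagon.
Qed.

Lemma opM_1l {a b : B} (x : operator a b) : opM (op1 b) x = x.
Proof.
apply: (@operator_eq _ _ _ (opM (op1 b) x) x (fun _ _ => eq_refl)).
move=> e w p q; rewrite !eqHom_id bmap_id comp_id_l comp_id_r.
pose r := rep (op1 b) (act x (id1 a :: nil)).
apply: (iso_cancel_r (i := bmapIso hcomp r (isoId (osum w)))).
change (repM (op1 b) x w ∘ r ▷ osum w = rep x w ∘ r ▷ osum w).
rewrite repME /= bmap_comp_r !comp_assoc.
rewrite (assoc2 (exch _ _)) !comp_assoc (assoc2 (blun_nat _)) !comp_assoc.
by rewrite -assoc_r (assoc2 (blun_comp _ _)).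
Qed.

(** [rep_one] turns the isomorphism to be cancelled into unit constraints, and the triangle identity
    concludes. *)
Lemma opM_1r {a b : B} (x : operator a b) : opM x (op1 a) = x.
Proof.
apply: (@operator_eq _ _ _ (opM x (op1 a)) x (fun _ _ => eq_refl)).
move=> e w p q; rewrite !eqHom_id bmap_id comp_id_l comp_id_r.
pose r := rep x (id1 a :: nil).
apply: (iso_cancel_r (i := bmapIso hcomp r (isoId (osum w)))).
change (repM x (op1 a) w ∘ r ▷ osum w = rep x w ∘ r ▷ osum w).
have h : repM x (op1 a) w ∘ r ▷ osum w = _ := repME x (op1 a) w.
rewrite h /r rep_one /= bmap_comp_l bmap_comp_r !comp_assoc -assoc_m.
by rewrite (assoc2 (btriangle _ _)).
Qed.

(** The actions agree only by [app_assoc], so identities along equalities occur at the hats and at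
    the values; [sumD_assoc] absorbs both and leaves [dL_assocV]. *)
Lemma opA_assoc {a b : B} (x y z : operator a b) :
  opA (opA x y) z = opA x (opA y z).
Proof.
apply: (@operator_eq _ _ _ (opA (opA x y) z) (opA x (opA y z))
  (fun c w => eq_sym (app_assoc (act x w) (act y w) (act z w)))).
move=> c w p q.
pose x1 := act x (id1 a :: nil); pose y1 := act y (id1 a :: nil).
pose z1 := act z (id1 a :: nil).
apply: (iso_cancel_r (i := bmapIso hcomp (sumD _ (x1 ++ y1) z1) (isoId (osum w)))).
apply: (iso_cancel_r (i := bmapIso hcomp
  (bmapIso (tens _) (sumD _ x1 y1) (isoId (osum z1))) (isoId (osum w)))).
have e := @sumD_assoc _ (hmon a b) x1 y1 z1 p.
have e' := @sumD_assoc _ (hmon c b) (act x w) (act y w) (act z w) q.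
have l : repA (opA x y) z w ∘ sumD _ (x1 ++ y1) z1 ▷ osum w =
    sumD _ (act x w ++ act y w) (act z w) ∘ (oplusm _ (rep (opA x y) w) (rep z w) ∘
      bwd (dL (osum (x1 ++ y1)) (osum z1) (osum w))) := repAE (opA x y) z w.
have l' : rep (opA x y) w ∘ sumD _ x1 y1 ▷ osum w =
    sumD _ (act x w) (act y w) ∘ (oplusm _ (rep x w) (rep y w) ∘
      bwd (dL (osum x1) (osum y1) (osum w))) := repAE x y w.
have r : repA x (opA y z) w ∘ sumD _ x1 (y1 ++ z1) ▷ osum w =
    sumD _ (act x w) (act y w ++ act z w) ∘ (oplusm _ (rep x w) (rep (opA y z) w) ∘
      bwd (dL (osum x1) (osum (y1 ++ z1)) (osum w))) := repAE x (opA y z) w.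
have r' : rep (opA y z) w ∘ sumD _ y1 z1 ▷ osum w =
    sumD _ (act y w) (act z w) ∘ (oplusm _ (rep y w) (rep z w) ∘
      bwd (dL (osum y1) (osum z1) (osum w))) := repAE y z w.
change (eqHom q ∘ repA (opA x y) z w ∘ sumD _ (x1 ++ y1) z1 ▷ osum w ∘
   oplusm _ (sumD _ x1 y1) (idm (osum z1)) ▷ osum w =
  repA x (opA y z) w ∘ eqHom p ▷ osum w ∘ sumD _ (x1 ++ y1) z1 ▷ osum w ∘
   oplusm _ (sumD _ x1 y1) (idm (osum z1)) ▷ osum w).
rewrite [RHS]comp_assoc [RHS]comp_assoc -!bmap_comp_r e !bmap_comp_r.
move: {e p} (repA (opA x y) z w) (rep (opA x y) w) (repA x (opA y z) w)
  (rep (opA y z) w) l l' r r' => A L A' R l l' r r'.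
rewrite !comp_assoc (assoc2 l) (assoc2 r) !comp_assoc.
rewrite (iso_flip (dL_nat (sumD _ x1 y1) (idm (osum z1)) (idm (osum w)))).
rewrite (assoc2 (iso_flip (dL_nat (idm (osum x1)) (sumD _ y1 z1) (idm (osum w))))).
rewrite !comp_assoc.
rewrite (assoc2 (eq_sym (bmap_comp _ _ _ _ _))) l'.
rewrite [in RHS](assoc2 (eq_sym (bmap_comp _ _ _ _ _))) r'.
rewrite !bmap_id !comp_id_r bmap_mid_l bmap_mid_r !comp_assoc.
rewrite (assoc3 e') !comp_assoc; do 2 congr (_ ∘ _).
rewrite (assoc2 (sassoc_nat _ _ _ _)) !comp_assoc; congr (_ ∘ _).
exact: dL_assocV.
Qed.

Lemma opA_0l {a b : B} (x : operator a b) : opA (op0 a b) x = x.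
Proof.
apply: (@operator_eq _ _ _ (opA (op0 a b) x) x (fun _ _ => eq_refl)).
move=> c w p q; rewrite !eqHom_id bmap_id comp_id_l comp_id_r.
pose x1 := act x (id1 a :: nil).
apply: (iso_cancel_r (i := bmapIso hcomp (slun (hmon a b) (osum x1)) (isoId (osum w)))).
have l : repA (op0 a b) x w ∘ slun (hmon a b) (osum x1) ▷ osum w =
  slun _ (osum (act x w)) ∘ (oplusm _ (bwd (zL (osum w))) (rep x w) ∘
    bwd (dL (munit (hmon a b)) (osum x1) (osum w))) := repAE (op0 a b) x w.
change (repA (op0 a b) x w ∘ slun (hmon a b) (osum x1) ▷ osum w =
  rep x w ∘ slun (hmon a b) (osum x1) ▷ osum w).
rewrite l bmap_rl !comp_assoc (assoc2 (slun_nat _ _)) !comp_assoc; congr (_ ∘ _).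
have e : slun (hmon a b) (osum x1) ▷ osum w ∘ (dL (munit (hmon a b)) (osum x1) (osum w) ∘
  oplusm (hmon c b) (zL (osum w)) (idm _)) =
  slun (hmon c b) _ := mphi_lun (rcomp (osum w)) (osum x1).
rewrite -e !comp_assoc (assoc2 (eq_sym (bmap_comp _ _ _ _ _))).
by rewrite fwd_bwd comp_id_l bmap_id comp_id_l fwd_bwd comp_id_r.
Qed.

Lemma opA_0r {a b : B} (x : operator a b) : opA x (op0 a b) = x.
Proof.
apply: (@operator_eq _ _ _ (opA x (op0 a b)) x (fun _ _ => app_nil_r _)) => c w p q.
pose x1 := act x (id1 a :: nil).
apply: (iso_cancel_r (i := bmapIso hcomp (sumD _ x1 nil) (isoId (osum w)))).
have l : repA x (op0 a b) w ∘ sumD _ x1 nil ▷ osum w =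
  sumD _ (act x w) nil ∘ (oplusm _ (rep x w) (bwd (zL (osum w))) ∘
    bwd (dL (osum x1) (munit (hmon a b)) (osum w))) := repAE x (op0 a b) w.
have e := @sumD_nil_r _ (hmon a b) x1 p; have e' := @sumD_nil_r _ (hmon c b) (act x w) q.
change (eqHom q ∘ repA x (op0 a b) w ∘ sumD _ x1 nil ▷ osum w =
  rep x w ∘ eqHom p ▷ osum w ∘ sumD _ x1 nil ▷ osum w).
rewrite [LHS]comp_assoc [RHS]comp_assoc -bmap_comp_r e l (assoc2 e') bmap_lr !comp_assoc.
rewrite (assoc2 (srun_nat _ _)) !comp_assoc; congr (_ ∘ _).
have h : srun (hmon a b) (osum x1) ▷ osum w ∘ (dL (osum x1) (munit (hmon a b)) (osum w) ∘
  oplusm (hmon c b) (idm _) (zL (osum w))) =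
  srun (hmon c b) _ := mphi_run (rcomp (osum w)) (osum x1).
rewrite -h !comp_assoc (assoc2 (eq_sym (bmap_comp _ _ _ _ _))).
by rewrite fwd_bwd comp_id_l bmap_id comp_id_l fwd_bwd comp_id_r.
Qed.

(** The isomorphisms agree by the nullary half of condition (2) for (- ∘ z^) ∘ sum w. *)
Lemma opM_0l {a b c : B} (z : operator a b) : opM (op0 b c) z = op0 a c.
Proof.
apply: (@operator_eq _ _ _ (opM (op0 b c) z) (op0 a c) (fun _ _ => eq_refl)).
move=> d w p q; rewrite !eqHom_id bmap_id comp_id_l comp_id_r.
pose z1 := act z (id1 a :: nil).
apply: (iso_cancel_r (i := bmapIso hcomp (isoInv (zL (osum z1))) (isoId (osum w)))).
have l : repM (op0 b c) z w ∘ bwd (zL (osum z1)) ▷ osum w =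
  bwd (zL (osum (act z w))) ∘ (munit (hmon b c) ◁ rep z w ∘
    bassoc (munit (hmon b c)) (osum z1) (osum w)) := repME (op0 b c) z w.
change (repM (op0 b c) z w ∘ bwd (zL (osum z1)) ▷ osum w =
  bwd (zL (osum w)) ∘ bwd (zL (osum z1)) ▷ osum w).
rewrite l; apply: (iso_cancel_l (i := zL (osum (act z w)))).
rewrite (assoc2 (fwd_bwd _)) comp_id_l (zL_nat (rep z w)) !comp_assoc; congr (_ ∘ _).
have [_ e] := smc_assocR c (osum z1) (osum w).
have {}e : bassoc (munit (hmon b c)) (osum z1) (osum w) ∘
  (zL (osum z1) ▷ osum w ∘ zL (osum w)) = zL (osum z1 ⋆ osum w) := e.
rewrite -e !comp_assoc (assoc2 (fwd_bwd _)) comp_id_l.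
by rewrite rw_iso comp_id_r.
Qed.

Lemma opM_0r {a b c : B} (x : operator b c) : opM x (op0 a b) = op0 a c.
Proof.
apply: (@operator_eq _ _ _ (opM x (op0 a b)) (op0 a c) (fun _ _ => act_nil x _)).
move=> d w p q.
(* After precomposition with [zR] and [zL] both sides start at the zero 1-cell, and [rep_nil] makes
   each an identity. *)
apply: (iso_cancel_r (i := bmapIso hcomp
  (isoComp (rep x (@nil (Hom a b))) (zR (hat x))) (isoId (osum w)))).
apply: (iso_cancel_r (i := zL (osum w))).
have l : repM x (op0 a b) w ∘ rep x (@nil (Hom a b)) ▷ osum w =
  rep x (@nil (Hom d b)) ∘ (hat x ◁ bwd (zL (osum w)) ∘
    bassoc (hat x) (munit (hmon a b)) (osum w)) := repME x (op0 a b) w.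
change (eqHom q ∘ repM x (op0 a b) w ∘
    (rep x (@nil (Hom a b)) ∘ zR (hat x)) ▷ osum w ∘ zL (osum w) =
  bwd (zL (osum w)) ∘ eqHom p ▷ osum w ∘
    (rep x (@nil (Hom a b)) ∘ zR (hat x)) ▷ osum w ∘ zL (osum w)).
move: (repM x (op0 a b) w) l => R l.
rewrite [RHS]comp_assoc [RHS]comp_assoc [in RHS](assoc2 (eq_sym (bmap_comp_r _ _ _ _))).
rewrite (rep_nil p) bmap_id comp_id_l bwd_fwd.
rewrite bmap_comp_r !comp_assoc (assoc2 l) !comp_assoc.
have [_ e] := smc_assocM (hat x) (osum w).
have {}e : bassoc (hat x) (munit (hmon a b)) (osum w) ∘
  (zR (hat x) ▷ osum w ∘ zL (osum w)) = hat x ◁ zL (osum w) ∘ zR (hat x) := e.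
by rewrite e (assoc2 (lw_iso' _ _)) comp_id_l (rep_nil q).
Qed.

(** Pointwise addition makes the actions agree by computation; the isomorphisms agree by
    [dL_bassocV]. *)
Lemma opM_Al {a b c : B} (x y : operator b c) (z : operator a b) :
  opM (opA x y) z = opA (opM x z) (opM y z).
Proof.
apply: (@operator_eq _ _ _ (opM (opA x y) z) (opA (opM x z) (opM y z)) (fun _ _ => eq_refl)).
move=> d w p q; rewrite !eqHom_id bmap_id comp_id_l comp_id_r.
pose z1 := act z (id1 a :: nil).
pose x1 := act x (id1 b :: nil); pose y1 := act y (id1 b :: nil).
apply: (iso_cancel_r (i := bmapIso hcomp (repA x y z1) (isoId (osum w)))).
apply: (iso_cancel_r (i := bmapIso hcomp (bmapIso hcomp (sumD _ x1 y1) (isoId (osum z1)))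
   (isoId (osum w)))).
have l : repM (opA x y) z w ∘ repA x y z1 ▷ osum w =
  repA x y (act z w) ∘ (osum (x1 ++ y1) ◁ rep z w ∘
    bassoc (osum (x1 ++ y1)) (osum z1) (osum w)) := repME (opA x y) z w.
have r : repA (opM x z) (opM y z) w ∘ sumD _ (act x z1) (act y z1) ▷ osum w =
  sumD _ (act x (act z w)) (act y (act z w)) ∘ (oplusm _ (repM x z w) (repM y z w) ∘
     bwd (dL (osum (act x z1)) (osum (act y z1)) (osum w))) := repAE (opM x z) (opM y z) w.
have s : repA x y z1 ∘ sumD _ x1 y1 ▷ osum z1 = sumD _ (act x z1) (act y z1) ∘
   (oplusm _ (rep x z1) (rep y z1) ∘ bwd (dL (osum x1) (osum y1) (osum z1))) := repAE x y z1.
have s' : repA x y (act z w) ∘ sumD _ x1 y1 ▷ osum (act z w) =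
  sumD _ (act x (act z w)) (act y (act z w)) ∘
   (oplusm _ (rep x (act z w)) (rep y (act z w)) ∘
   bwd (dL (osum x1) (osum y1) (osum (act z w)))) := repAE x y (act z w).
have u : repM x z w ∘ rep x z1 ▷ osum w = rep x (act z w) ∘ (osum x1 ◁ rep z w ∘
  bassoc (osum x1) (osum z1) (osum w)) := repME x z w.
have v : repM y z w ∘ rep y z1 ▷ osum w = rep y (act z w) ∘ (osum y1 ◁ rep z w ∘
  bassoc (osum y1) (osum z1) (osum w)) := repME y z w.
change (repM (opA x y) z w ∘ repA x y z1 ▷ osum w ∘ (sumD _ x1 y1 ▷ osum z1) ▷ osum w =
  repA (opM x z) (opM y z) w ∘ repA x y z1 ▷ osum w ∘ (sumD _ x1 y1 ▷ osum z1) ▷ osum w).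
move: (repM (opA x y) z w) (repA x y z1) (repA (opM x z) (opM y z) w) (repA x y (act z w))
  (repM x z w) (repM y z w) l r s s' u v => R S T U V W l r s s' u v.
rewrite l [RHS]comp_assoc -[in RHS]bmap_comp_r s !bmap_comp_r.
rewrite !comp_assoc assoc_r (assoc2 (eq_sym (exch _ _))) !comp_assoc (assoc2 s') (assoc2 r).
rewrite !comp_assoc; congr (_ ∘ _).
have h := iso_flip (dL_nat (idm (osum x1)) (idm (osum y1)) (rep z w)).
rewrite bmap_id in h; rewrite (assoc2 h) {h}.
rewrite (assoc2 (iso_flip (dL_nat (rep x z1) (rep y z1) (idm (osum w))))) !comp_assoc.
rewrite [in RHS](assoc2 (eq_sym (bmap_comp _ _ _ _ _))) u v !bmap_comp !comp_assoc.
by do 2 congr (_ ∘ _); exact: dL_bassocV.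
Qed.

End StrictLaws.

Lemma image_identity {M : Category} {E : Type} (f : E -> M) (x y : image f)
    (s : hom x y) : x = y -> (forall p : f x = f y, s = eqHom p) -> IsIdentity s.
Proof.
by move=> e; case: y / e s => s h; exists eq_refl; rewrite /= (h eq_refl).
Qed.

(** Identity components make the functors agree on objects, and naturality then makes them agree on
    morphisms. *)
Lemma CAT_identity {M N : Category} (F G : CAT M N) (s : hom F G) :
  (forall x, IsIdentity (nt s x)) -> IsIdentity s.
Proof.
case: F s => F fF iF cF s h.
have e : F = fob G.
  by apply: functional_extensionality => x; case: (h x).
case: G s h e => G fG iG cG s h /= e; case: G / e fG iG cG s h => fG iG cG s h.
have hs x : s x = idm (F x) by case: (h x) => p ->; exact: eqHom_id.
have e : fF = fG.
  apply: functional_extensionality_dep => x; apply: functional_extensionality_dep => y.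
  apply: functional_extensionality_dep => k.
  by have := nt_nat s k; rewrite !hs comp_id_l comp_id_r.
case: fG / e iG cG s h hs => iG cG s h hs.
rewrite (proof_irrelevance _ iG iF) (proof_irrelevance _ cG cF) in s h hs *.
by exists eq_refl; apply: nt_eq => x; rewrite hs.
Qed.

(** * The PC-category of operators *)

Section StrictModel.
Context {B : SMCategory}.

(** [isoM] and [isoA] are the very isomorphisms inverted in [repM] and [repA]; this choice makes the
    strict constraints identities. *)
Definition operators : presentation B :=
  @Build_presentation B (@operator B) (@hat B) (@op1 B) (@opM B) (@op0 B) (@opA B)
    (@opG B) (fun a => isoInv (srun _ (id1 a)))
    (fun a b c x y => rep x (act y (id1 a :: nil))) (fun a b => isoId _)
    (fun a b x y => sumD _ (act x (id1 a :: nil)) (act y (id1 a :: nil)))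
    (fun a b f => isoInv (hat_gen f)).

Notation C := (transportSMC operators).

Lemma strict_bassoc {a b c d : C} (h : Hom c d) (g : Hom b c) (f : Hom a b) :
  IsIdentity (@bassoc C a b c d h g f).
Proof.
apply: image_identity => [|p]; first exact: opM_assoc.
(* The constraint and the identity are both covered by [bassoc]; for the identity this is [repME] at
   the value of [f] on the list of [id1]. *)
apply: (cov_eq (cov_bassoc (P := operators) (isoId _) (isoId _) (isoId _)) _ eq_refl).
rewrite eqHom_id /cov /= comp_id_l !bmap_id !comp_id_r [RHS]comp_assoc.
exact: (@repME B b c d a h g _).
Qed.

Lemma strict_blun {a b : C} (f : Hom a b) : IsIdentity (@blun C a b f).
Proof.
apply: image_identity => [|p]; first exact: opM_1l.
apply: (cov_eq (cov_blun (P := operators) (isoId _)) _ eq_refl).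
rewrite eqHom_id /cov /= !comp_id_l !comp_assoc -bmap_comp fwd_bwd comp_id_l bmap_id.
exact: comp_id_r.
Qed.

Lemma strict_brun {a b : C} (f : Hom a b) : IsIdentity (@brun C a b f).
Proof.
apply: image_identity => [|p]; first exact: opM_1r.
apply: (cov_eq (cov_brun (P := operators) (isoId _)) _ eq_refl).
rewrite eqHom_id /cov /= !comp_id_l rep_one !comp_assoc -bmap_comp_l fwd_bwd bmap_id.
exact: comp_id_r.
Qed.

Lemma strict_sassoc {a b : C} (x y z : Hom a b) : IsIdentity (sassoc (@hmon C a b) x y z).
Proof.
apply: image_identity => [|p]; first exact: opA_assoc.
apply: (cov_eq (cov_sassoc (@isoA _ operators a b) (isoId _) (isoId _) (isoId _)) _ eq_refl).
rewrite /cov /= !bmap_id !comp_id_r [RHS]comp_assoc.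
exact: (@sumD_assoc _ (@hmon B a b) _ _ _ p).
Qed.

Lemma strict_slun {a b : C} (x : Hom a b) : IsIdentity (slun (@hmon C a b) x).
Proof.
apply: image_identity => [|p]; first exact: opA_0l.
apply: (cov_eq (cov_slun (iso0 operators a b) (@isoA _ operators a b) (isoId _)) _ eq_refl).
by rewrite eqHom_id /cov /= bmap_id !comp_id_r comp_id_l.
Qed.

Lemma strict_srun {a b : C} (x : Hom a b) : IsIdentity (srun (@hmon C a b) x).
Proof.
apply: image_identity => [|p]; first exact: opA_0r.
apply: (cov_eq (cov_srun (iso0 operators a b) (@isoA _ operators a b) (isoId _)) _ eq_refl).
rewrite /cov /= bmap_id !comp_id_r comp_id_l.
exact: (@sumD_nil_r _ (@hmon B a b) _ p).
Qed.

Lemma strict_distL {a b c : C} (x y : Hom b c) : IsIdentity (mphi (@distL C a b c) x y).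
Proof.
apply: CAT_identity => z; apply: image_identity => [|p]; first exact: eq_sym (opM_Al _ _ _).
apply: (cov_eq (cov_dL (P := operators) (isoId _) (isoId _) (isoId _)) _ eq_refl).
rewrite eqHom_id /cov comp_id_l /= !bmap_id !comp_id_r [RHS]comp_assoc.
exact: (eq_sym (@repA_dL B b c a x y (act z (@id1 B a :: nil)))).
Qed.

Lemma strict_zeroL {a b c : C} : IsIdentity (mphi0 (@distL C a b c)).
Proof.
apply: CAT_identity => z; apply: image_identity => [|p]; first exact: eq_sym (opM_0l _).
apply: (cov_eq (cov_zL (P := operators) (isoId _)) _ eq_refl).
rewrite eqHom_id /cov /= bmap_id !comp_id_r; exact: (eq_sym (bwd_fwd (zL _))).
Qed.

Lemma strict_zeroR {a b c : C} : IsIdentity (mphi0 (@distR C a b c)).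
Proof.
apply: CAT_identity => z; apply: image_identity => [|p]; first exact: eq_sym (opM_0r _).
apply: (cov_eq (cov_zR (P := operators) (isoId _)) _ eq_refl).
rewrite /cov /= bmap_id !comp_id_r.
(* The identity is expanded by [rep_nil] along [eq_sym p], so that the two identities along
   equalities cancel. *)
rewrite -[LHS]comp_id_r -(@rep_nil B b c z a (eq_sym p)) -[LHS]comp_assoc.
rewrite (eqHom_comp (eq_sym p) p eq_refl).
exact: comp_id_l.
Qed.

Definition strictification : PCCategory.
Proof.
refine (@Build_PCCategory C _ _ _ _).
- abstract (split; [|split]; [exact: @strict_bassoc | exact: @strict_blun | exact: @strict_brun]).
- abstract (move=> a b; split; [|split];
    [exact: strict_sassoc | exact: strict_slun | exact: strict_srun]).
- abstract (move=> a b c; split; [exact: strict_distL | exact: strict_zeroL]).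
- abstract (move=> a b c; exact: strict_zeroR).
Defined.

End StrictModel.

Theorem theorem1p2 :
  forall B : SMCategory,
  exists (C : PCCategory) (F : SMCFunctor B C), IsBiequivalence F.
Proof.
move=> B; exists (@strictification B), (genSMC (@operators B)); exact: gen_biequivalence.
Qed.
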